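(* For each integer $N\ge2$ let $\Phi_N:\mathbb R^{N-1}\times\mathbb R^{N-1}\to\mathbb R^{N-1}\times\mathbb R^{N-1}$, $(X,Y)=\Phi_N(x,y)$, be a global Birkhoff map for the Toda lattice with $N$ particles (in the sense of the context), and let $Q^{\Phi_N}:=d^2\Phi_N(0,0)$ be its second differential at the origin. Then for any $s\ge0$, $\sigma\ge0$ there exist strictly positive $R$, $C$ and $N_{s,\sigma}\in\mathbb N$ such that, for any $N\ge N_{s,\sigma}$ and any $\alpha\in\mathbb R$, $$\sup_{v\in B^{s,\sigma}_{\mathbb R}(R/N^\alpha)}\big\|Q^{\Phi_N}(v,v)\big\|_{\mathcal P^{s,\sigma}}\ \ge\ C\,R^2\,N^{2-2\alpha}.$$
   Context: Toda lattice. For an integer $N\ge2$ let $H_{Toda}(p,q)=\frac12\sum_{j=0}^{N-1}p_j^2+\sum_{j=0}^{N-1}e^{q_j-q_{j+1}}$ with periodic boundary conditions $q_N=q_0$, $p_N=p_0$, restricted to the invariant subspace $\sum_jq_j=0=\sum_jp_j$. Discrete Fourier transform: $\hat q_k=\frac1{\sqrt N}\sum_{j=0}^{N-1}q_je^{2\pi \mathrm i jk/N}$ ($N$-periodic in $k$), similarly $\hat p_k$. Put $\omega_k=\omega(k/N)=2\sin(k\pi/N)$ and, for $1\le k\le N-1$, $$\xi_k=\frac{\hat p_k+\mathrm i\omega_k\hat q_k}{\sqrt{2\omega_k}},\quad \eta_k=\frac{\hat p_{N-k}-\mathrm i\omega_k\hat q_{N-k}}{\sqrt{2\omega_k}},\quad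 X_k=\frac{\xi_k+\eta_k}{\sqrt2},\quad Y_k=\frac{\xi_k-\eta_k}{\mathrm i\sqrt2}.$$ Real $(p,q)$ correspond to real $(X,Y)$ and $\sum_jdp_j\wedge dq_j=\sum_kdX_k\wedge dY_k$. $H_{Toda}$ also denotes the Hamiltonian written in the coordinates $(X,Y)$. Norms. $[k]_N=\min(|k|,|N-k|)$. $\mathcal P^{s,\sigma}$ is $\mathbb C^{N-1}\times\mathbb C^{N-1}$ with norm $\|(X,Y)\|^2_{\mathcal P^{s,\sigma}}=\frac1N\sum_{k=1}^{N-1}[k]_N^{2s}e^{2\sigma[k]_N}\omega_k\frac{|X_k|^2+|Y_k|^2}2$; $B^{s,\sigma}(R)$ is the ball of radius $R$ centered at $0$ and $B^{s,\sigma}_{\mathbb R}(R)=B^{s,\sigma}(R)\cap(\mathbb R^{N-1}\times\mathbb R^{N-1})$. Global Birkhoff map. A global real analytic symplectic (for $\sum_kdX_k\wedge dY_k$) diffeomorphism $\Phi_N$ of $\mathbb R^{N-1}\times\mathbb R^{N-1}$, with $\Phi_N(0,0)=(0,0)$, such that (i) $H_{Toda}\circ\Phi_N$ is a function of the actions $I_k=(x_k^2+y_k^2)/2$ only; (ii) $d\Phi_N(0,0)$ is the identity. (For every $N\ge2$ such maps exist, by a theorem of Henrici and Kappeler.) *)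

(* Defs.v *)
From mathcomp Require Import all_boot all_order all_algebra.
From mathcomp Require Import all_classical all_reals all_analysis.
From mathcomp.real_closed Require Export complex.

Set Implicit Arguments.
Unset Strict Implicit.
Unset Printing Implicit Defensive.

Import Order.TTheory GRing.Theory Num.Theory.
Import numFieldNormedType.Exports.

Local Open Scope classical_set_scope.
Local Open Scope ring_scope.

(* Pairs (X, Y); the mode k of the mathematics, 1 <= k <= N - 1, is the index
   k - 1 : 'I_N.-1, so that an index k stands for the mode k.+1. *)
Notation phase K N := ('rV[K]_N.-1 * 'rV[K]_N.-1)%type.

Section Toda.
Context {R : realType}.

(* q_N = q_0: ordS is the cyclic successor on 'I_N. *)
Definition toda_ham N (p q : 'rV[R]_N) : R :=
  2^-1 * \sum_j (p 0 j) ^+ 2 + \sum_j expR (q 0 j - q 0 (ordS j)).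

Definition zero_sum N (u : 'rV[R]_N) : Prop := \sum_j u 0 j = 0.

Definition expi (t : R) : R[i] := (cos t +i* sin t)%C.

Definition dft N (u : 'rV[R]_N) (k : nat) : R[i] :=
  ((Num.sqrt (N%:R : R))^-1)%:C%C *
  \sum_(j < N) (u 0 j)%:C%C * expi (2 * pi * (j * k)%:R / N%:R).

Definition omega (N k : nat) : R := 2 * sin (k%:R * pi / N%:R).

Definition toda_xi N (p q : 'rV[R]_N) (k : nat) : R[i] :=
  (dft p k + 'i%C * (omega N k)%:C%C * dft q k)
    / (Num.sqrt (2 * omega N k))%:C%C.

Definition toda_eta N (p q : 'rV[R]_N) (k : nat) : R[i] :=
  (dft p (N - k) - 'i%C * (omega N k)%:C%C * dft q (N - k))
    / (Num.sqrt (2 * omega N k))%:C%C.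

Definition toda_XY N (p q : 'rV[R]_N) : phase R[i] N :=
  (\row_k ((toda_xi p q k.+1 + toda_eta p q k.+1) / (Num.sqrt 2)%:C%C),
   \row_k ((toda_xi p q k.+1 - toda_eta p q k.+1)
             / ('i%C * (Num.sqrt 2)%:C%C))).

Definition complexify N (v : phase R N) : phase R[i] N :=
  (map_mx (fun x => x%:C%C) v.1, map_mx (fun x => x%:C%C) v.2).

(* [k]_N, for 0 <= k <= N *)
Definition circ_dist (N k : nat) : nat := minn k (N - k).

Definition Pnorm N (s sigma : R) (v : phase R[i] N) : R :=
  Num.sqrt (N%:R^-1 * \sum_(k < N.-1)
    ((circ_dist N k.+1)%:R `^ (2 * s)
     * expR (2 * sigma * (circ_dist N k.+1)%:R)
     * omega N k.+1
     * ((ComplexField.Normc.normc (v.1 0 k) ^+ 2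
         + ComplexField.Normc.normc (v.2 0 k) ^+ 2) / 2))).

Definition Pball N (s sigma r : R) : set (phase R[i] N) :=
  [set v | Pnorm s sigma v < r].

Definition Pball_real N (s sigma r : R) : set (phase R N) :=
  [set v | Pball s sigma r (complexify v)].

Definition phase_coord N (z : phase R N) (i : 'I_N.-1 + 'I_N.-1) : R :=
  match i with inl k => z.1 0 k | inr k => z.2 0 k end.

(* Partial sum, over the multi-indices with all entries < m, of the power
   series with coefficients c in the variables t_i *)
Definition mpseries (I : finType) (c : (I -> nat) -> R) (t : I -> R) (m : nat) : R :=
  \sum_(a : {ffun I -> 'I_m})
     c (fun i => a i : nat) * \prod_i t i ^+ (a i : nat).

(* f is, on a polydisc centered at a, the sum of an absolutely convergent
   power series. *)
Definition analytic_at N (f : phase R N -> R) (a : phase R N) : Prop :=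
  exists (c : ('I_N.-1 + 'I_N.-1 -> nat) -> R) (r : R), 0 < r /\
    forall z : phase R N,
      let t i := phase_coord z i - phase_coord a i in
      (forall i, `|t i| < r) ->
      cvgn (mpseries (fun al => `|c al|) (fun i => `|t i|)) /\
      mpseries c t @ \oo --> f z.

Definition real_analytic N (F : phase R N -> phase R N) : Prop :=
  forall a i, analytic_at (fun z => phase_coord (F z) i) a.

Definition analytic_diffeo N (F : phase R N -> phase R N) : Prop :=
  real_analytic F /\
  exists G, [/\ real_analytic G, cancel F G & cancel G F].

(* \sum_k dX_k /\ dY_k *)
Definition sympl_form N (u v : phase R N) : R :=
  \sum_k (u.1 0 k * v.2 0 k - v.1 0 k * u.2 0 k).

Definition symplectic N (F : phase R N -> phase R N) : Prop :=
  forall z u v, sympl_form ('d F z u) ('d F z v) = sympl_form u v.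

Definition actions N (w : phase R N) : 'rV[R]_N.-1 :=
  \row_k (((w.1 0 k) ^+ 2 + (w.2 0 k) ^+ 2) / 2).

(* (p, q) |-> (X, Y) is one-to-one from {zero_sum p, zero_sum q} onto the real
   pairs (X, Y), so the value of H_Toda at the real point (X, Y) is
   toda_ham p q for the only such (p, q) with these coordinates. *)
Definition toda_action_only N (F : phase R N -> phase R N) : Prop :=
  exists h : 'rV[R]_N.-1 -> R, forall (w : phase R N) (p q : 'rV[R]_N),
    zero_sum p -> zero_sum q -> toda_XY p q = complexify (F w) ->
    toda_ham p q = h (actions w).

Record birkhoff_map N (F : phase R N -> phase R N) : Prop := BirkhoffMap {
  birkhoff_diffeo : analytic_diffeo F;
  birkhoff_symplectic : symplectic F;
  birkhoff_0 : F 0 = 0;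
  birkhoff_actions : toda_action_only F;
  birkhoff_diff0 : forall v, 'd F 0 v = v
}.

(* d^2 f(z)(u, v), without a factor 1/2 *)
Definition diff2 (V W : normedModType R) (f : V -> W) (z u v : V) : W :=
  'd (fun w => 'd f w u) z v.

End Toda.

(* Main.v *)
Require Import Defs.
From mathcomp Require Import all_boot all_order all_algebra.
From mathcomp Require Import all_classical all_reals all_analysis.
From mathcomp Require Import ring lra.
From HB Require Import structures.

(* Write Q = d^2 Phi(0,0) and T(u,v,w) = Omega(Q(u,v), w), where Omega is the
   symplectic form. Differentiating Phi^* Omega = Omega at the origin shows that
   T is a totally symmetric trilinear form. The function H o Phi depends on the
   actions only, so it is even, and its cubic part
   H_3(w) + <grad H_2(w), Q(w,w)> / 2 vanishes. After polarization this is the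
   homological equation
     T(Bu,v,w) + T(u,Bv,w) + T(u,v,Bw) = - 6 H_3(u,v,w),
   with B the generator of the flow of H_2. Evaluated on two vectors of mode 1
   and one of mode 2 with opposite phases, its left-hand side carries the small
   divisor 2 omega_1 - omega_2 ~ N^-3 while H_3 is of order N^-2: hence Q(v,v)
   has a component of order N on mode 2 for some v of norm O(1) in mode 1, and
   rescaling v to the radius of the ball gives the bound. *)

Set Implicit Arguments.
Unset Strict Implicit.
Unset Printing Implicit Defensive.

Import Order.TTheory GRing.Theory Num.Theory.
Import numFieldNormedType.Exports.

Local Open Scope classical_set_scope.
Local Open Scope ring_scope.

(** * Second-order jets of real analytic maps *)

(** The second differential is an iterated ['d], which is meaningful only once differentiability is
    established, while the hypothesis provides convergent power series and says nothing about their
    derivatives. Hence the estimates comparing remainders at two nearby points: they give both the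
    differential near the origin and its first-order variation, without differentiating a series
    term by term. The bound holds for every Birkhoff map because the resonant part of Q is already
    fixed by H_2 and H_3. Real waves replace complex normal modes: p_j and q_j - q_(j+1) are samples
    of one function at integer and half-integer points. Powers of N: the factor 1/N of the norm and
    omega_1 of order 1/N allow vectors of mode 1 with Euclidean length of order N in a ball of
    radius of order 1. The square of that length gives N^2, the small divisor gives N, and the norm
    on mode 2 takes back one N. What remains is N^2. *)

Section PowerSeries.
Context {R : realType} {I : finType}.
Implicit Types (c : (I -> nat) -> R) (t h : I -> R).

(** Majorant argument: telescoping bounds the difference of two products by the same expression in
    [X] and [Y], so that estimates in many variables reduce to powers of two real numbers. *)
Lemma prod_sub_le (J : Type) (r : seq J) (A B X Y : J -> R) :
  (forall j, `|A j| <= X j) -> (forall j, `|B j| <= Y j) ->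
  (forall j, Y j <= X j) -> (forall j, `|A j - B j| <= X j - Y j) ->
  `|\prod_(j <- r) A j - \prod_(j <- r) B j|
    <= \prod_(j <- r) X j - \prod_(j <- r) Y j.
Proof.
move=> AX BY YX ABXY.
have Y0 j : 0 <= Y j by exact: le_trans (normr_ge0 _) (BY j).
have X0 j : 0 <= X j by exact: le_trans (normr_ge0 _) (AX j).
elim: r => [|j r IH]; first by rewrite !big_nil !subrr normr0.
rewrite !big_cons.
have PX : `|\prod_(j <- r) A j| <= \prod_(j <- r) X j.
  by rewrite normr_prod; apply: ler_prod => k _; rewrite normr_ge0 AX.
set a := \prod_(j <- r) A j in IH PX *; set b := \prod_(j <- r) B j in IH *.
set x := \prod_(j <- r) X j in IH PX *; set y := \prod_(j <- r) Y j in IH *.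
have -> : A j * a - B j * b = (A j - B j) * a + B j * (a - b) by ring.
have -> : X j * x - Y j * y = (X j - Y j) * x + Y j * (x - y) by ring.
by apply: le_trans (ler_normD _ _) _; rewrite !normrM lerD// ler_pM.
Qed.

Lemma monomial_sub_le (a : I -> nat) t h (x y : R) :
  (forall i, `|t i| <= x) -> (forall i, `|h i| <= y) -> 0 <= x -> 0 <= y ->
  `|\prod_i (t i + h i) ^+ a i - \prod_i t i ^+ a i|
    <= (x + y) ^+ (\sum_i a i) - x ^+ (\sum_i a i).
Proof.
move=> tx hy x0 y0; rewrite !expr_sum.
have thxy i : `|t i + h i| <= x + y by apply: le_trans (ler_normD _ _) _; rewrite lerD.
apply: prod_sub_le => i.
- by rewrite normrX lerXn2r// nnegrE addr_ge0.
- by rewrite normrX lerXn2r// nnegrE.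
- by rewrite lerXn2r ?nnegrE ?addr_ge0// lerDl.
(* Each power is itself a product of equal factors, so the majorant argument applies a second
   time. *)
- rewrite -[a i]subn0 -!prodr_const_nat.
  apply: prod_sub_le => // j; first by rewrite lerDl.
  by rewrite ![_ + _ - _]addrAC !subrr !add0r.
Qed.

Lemma exprD_sub_le (n : nat) (x y : R) : 0 <= x -> 0 <= y ->
  (x + y) ^+ n - x ^+ n <= n%:R * y * (x + y) ^+ n.-1.
Proof.
move=> x0 y0; rewrite subrXX (_ : x + y - x = y); last by ring.
rewrite (_ : n%:R * y * (x + y) ^+ n.-1 = y * \sum_(i < n) (x + y) ^+ n.-1); last first.
  by rewrite sumr_const card_ord -[_ ^+ _ *+ _]mulr_natl; ring.
rewrite ler_wpM2l//.
apply: ler_sum => i _.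
rewrite -(subnK (_ : i <= n.-1)%N); last by rewrite -ltnS prednK//; case: (n) i => [[]|].
rewrite exprD addnK ler_wpM2l ?exprn_ge0 ?addr_ge0//.
by rewrite lerXn2r ?nnegrE ?addr_ge0// lerDl.
Qed.

Lemma nat_le_exp2 (n : nat) : n%:R * 2^-1 ^+ n <= 1 :> R.
Proof.
rewrite exprVn ler_pdivrMr ?exprn_gt0// mul1r -natrX ler_nat.
exact: ltnW (ltn_expl _ _).
Qed.

(** In degree m + 3 the difference is at most [y * (x + y) ^+ 2] times (m + 3) (x + y)^m. As
    [x + y <= p / 2], the factor (m + 3) 2^(-m) is at most 8 = 2^3 in every degree: halving the
    radius pays for the factor produced by differentiation. *)
Lemma monomial_sub_tail (a : I -> nat) t h (x y p : R) : 0 < p ->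
  (forall i, `|t i| <= x) -> (forall i, `|h i| <= y) -> 0 <= x -> 0 <= y ->
  x + y <= p / 2 -> (3 <= \sum_i a i)%N ->
  `|\prod_i (t i + h i) ^+ a i - \prod_i t i ^+ a i|
    <= 8 / p ^+ 3 * (y * (x + y) ^+ 2) * \prod_i p ^+ a i.
Proof.
move=> p0 tx hy x0 y0 xyp n3; rewrite -expr_sum.
apply: le_trans (monomial_sub_le _ tx hy x0 y0) _.
apply: le_trans (exprD_sub_le _ x0 y0) _.
move: (\sum_i _)%N n3 => n n3; rewrite -(subnK n3); move: (n - 3)%N => m.
rewrite (_ : (m + 3).-1 = m + 2)%N; last by rewrite addn3 addn2.
rewrite !exprD.
have pn0 : p != 0 by rewrite gt_eqF.
rewrite (_ : 8 / p ^+ 3 * (y * (x + y) ^+ 2) * (p ^+ m * p ^+ 3) =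
   (y * (x + y) ^+ 2) * (8 * p ^+ m)); last by move: (p ^+ m) => z; field.
rewrite (_ : _%:R * y * _ = (y * (x + y) ^+ 2) * ((m + 3)%:R * (x + y) ^+ m)); last by ring.
rewrite ler_wpM2l ?mulr_ge0 ?exprn_ge0 ?addr_ge0//.
have xm : (x + y) ^+ m <= p ^+ m * 2^-1 ^+ m.
  rewrite -exprMn lerXn2r ?nnegrE ?addr_ge0//; exact: le_trans (addr_ge0 _ _) xyp.
apply: le_trans (ler_wpM2l (ler0n _ _) xm) _.
rewrite mulrCA mulrC ler_wpM2r ?exprn_ge0 ?(ltW p0)//.
have := nat_le_exp2 (m + 3); rewrite exprD; set z := 2^-1 ^+ m => H.
have -> : (m + 3)%:R * z = 8 * ((m + 3)%:R * (z * 2^-1 ^+ 3)) by field.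
by rewrite ler_piMr.
Qed.

Definition is_quadratic (P : (I -> R) -> R) : Prop :=
  exists (c0 : R) (l : I -> R) (q : I -> I -> R), forall t,
    P t = c0 + \sum_i l i * t i + \sum_i \sum_j q i j * (t i * t j).

Lemma is_quadratic0 : is_quadratic (fun=> 0).
Proof.
exists 0, (fun=> 0), (fun _ _ => 0) => t; rewrite !big1 ?addr0// => i _.
  by rewrite big1// => j _; rewrite mul0r.
by rewrite mul0r.
Qed.

Lemma is_quadraticD P Q : is_quadratic P -> is_quadratic Q ->
  is_quadratic (fun t => P t + Q t).
Proof.
move=> [c [l [q Pt]]] [d [m [r Qt]]].
exists (c + d), (fun i => l i + m i), (fun i j => q i j + r i j) => t.
rewrite Pt Qt addrACA [c + _ + (d + _)]addrACA -!big_split/=; congr (_ + _ + _).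
  by apply: eq_bigr => i _; rewrite mulrDl.
by apply: eq_bigr => i _; rewrite -big_split/=; apply: eq_bigr => j _; rewrite mulrDl.
Qed.

Lemma is_quadraticZ k P : is_quadratic P -> is_quadratic (fun t => k * P t).
Proof.
move=> [c [l [q Pt]]].
exists (k * c), (fun i => k * l i), (fun i j => k * q i j) => t.
rewrite Pt !mulrDr !mulr_sumr; congr (_ + _ + _).
  by apply: eq_bigr => i _; rewrite mulrA.
by apply: eq_bigr => i _; rewrite mulr_sumr; apply: eq_bigr => j _; rewrite mulrA.
Qed.

Lemma is_quadratic_sum (J : Type) (r : seq J) (p : pred J) P :
  (forall j, p j -> is_quadratic (P j)) ->
  is_quadratic (fun t => \sum_(j <- r | p j) P j t).
Proof.
move=> HP; rewrite (_ : (fun t => _) = \sum_(j <- r | p j) P j); last first.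
  by apply/funext => t; rewrite fct_sumE.
by elim/big_ind: _ => //; [exact: is_quadratic0|exact: is_quadraticD].
Qed.

Lemma monomial_pop (a : I -> nat) (n : nat) : (\sum_i a i = n.+1)%N ->
  exists i (b : I -> nat), (\sum_i b i = n)%N /\
    forall t, \prod_i t i ^+ a i = t i * \prod_i t i ^+ b i.
Proof.
move=> an; have [i ai] : exists i, (0 < a i)%N.
  apply: contrapT => /forallNP H; have : (\sum_i a i = 0)%N; last by rewrite an.
  by rewrite big1// => i _; apply/eqP; rewrite -leqn0 leqNgt; apply/negP/H.
exists i, (fun j => if j == i then (a j).-1 else a j); split.
  apply/eqP; rewrite -eqSS -an (bigD1 i)//= eqxx [X in _ == X](bigD1 i)//=.
  rewrite -addSn prednK// eqn_add2l; apply/eqP/eq_bigr => j /negPf ->//.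
move=> t; rewrite (bigD1 i)//= [in RHS](bigD1 i)//= eqxx mulrA -exprS prednK//.
by congr (_ * _); apply: eq_bigr => j /negPf ->.
Qed.

Lemma is_quadratic_monomial (a : I -> nat) : (\sum_i a i < 3)%N ->
  is_quadratic (fun t => \prod_i t i ^+ a i).
Proof.
have m0 (b : I -> nat) : (\sum_i b i = 0)%N -> forall t, \prod_i t i ^+ b i = 1.
  move=> b0 t; rewrite big1// => i _; move/eqP: b0; rewrite sum_nat_eq0.
  by move=> /forallP/(_ i)/= /eqP ->.
have m1 (b : I -> nat) : (\sum_i b i = 1)%N -> exists i, forall t, \prod_i t i ^+ b i = t i.
  move=> /monomial_pop[i [b' [b'0 E]]]; exists i => t.
  by rewrite E m0// mulr1.
case E : (\sum_i a i)%N => [|[|[|//]]] _.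
- exists 1, (fun=> 0), (fun _ _ => 0) => t; rewrite m0// !big1 ?addr0// => i _.
    by rewrite big1// => j _; rewrite mul0r.
  by rewrite mul0r.
- have [i Ei] := m1 _ E.
  exists 0, (fun j => (j == i)%:R), (fun _ _ => 0) => t.
  rewrite Ei add0r (bigD1 i)//= eqxx mul1r !big1 ?addr0// => j.
    by move=> _; rewrite big1// => k _; rewrite mul0r.
  by move=> /negPf ->; rewrite mul0r.
- have [i [b [/m1[k Ek] Ei]]] := monomial_pop E.
  exists 0, (fun=> 0), (fun j j' => ((j == i) && (j' == k))%:R) => t.
  rewrite Ei Ek add0r big1 ?add0r; last by move=> j _; rewrite mul0r.
  rewrite (bigD1 i)//= (bigD1 k)//= !eqxx mul1r !big1 ?addr0// => j.
    by move=> /negPf ->; rewrite big1// => j' _; rewrite mul0r.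
  by move=> /negPf ->; rewrite andbF mul0r.
Qed.

(** The index set of the partial sums changes with [m], but a multi-index of total degree below 3
    has all its entries below 3: the quadratic part is constant from [m = 3] on. *)
Lemma low_degree_reindex (F : (I -> nat) -> R) (m : nat) : (3 <= m)%N ->
  \sum_(a : {ffun I -> 'I_m} | (\sum_i a i < 3)%N) F (fun i => a i : nat) =
  \sum_(a : {ffun I -> 'I_3} | (\sum_i a i < 3)%N) F (fun i => a i : nat).
Proof.
move=> m3; pose w (a : {ffun I -> 'I_3}) := [ffun i => widen_ord m3 (a i)].
pose v (a : {ffun I -> 'I_m}) : {ffun I -> 'I_3} := [ffun i => inord (a i)].
rewrite (reindex_onto w v) /=; last first.
  move=> a a3; apply/ffunP => i; rewrite !ffunE; apply/val_inj => /=.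
  rewrite inordK//; apply: leq_trans a3; rewrite ltnS (bigD1 i)//=.
  exact: leq_addr.
have wE a : (fun i => w a i : nat) = (fun i => a i : nat).
  by apply/funext => i; rewrite ffunE.
apply: eq_big => a; last by rewrite wE.
rewrite (eq_bigr (fun i => a i : nat)); last by move=> i _; rewrite ffunE.
rewrite (_ : v (w a) = a) ?eqxx ?andbT//.
by apply/ffunP => i; rewrite !ffunE; apply/val_inj; rewrite /= inordK.
Qed.

End PowerSeries.

Section Jet.
Context {R : realType} {I : finType}.
Implicit Types t h : I -> R.

(** The remainder [f - P] is compared at two points: the error is linear in the increment [y], which
    later permits division by its length, and quadratic in the total radius. It follows term by term
    from [monomial_sub_tail], with the absolute series at the constant point [p] as common
    majorant. *)
Lemma mpseries_jet (c : (I -> nat) -> R) (f : (I -> R) -> R) (r : R) : 0 < r ->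
  (forall t, (forall i, `|t i| < r) ->
    cvgn (mpseries (fun al => `|c al|) (fun i => `|t i|)) /\
    mpseries c t @ \oo --> f t) ->
  exists (P : (I -> R) -> R) (C d : R), [/\ is_quadratic P, 0 <= C, 0 < d &
    forall t h x y, (forall i, `|t i| <= x) -> (forall i, `|h i| <= y) ->
      0 <= x -> 0 <= y -> x + y <= d ->
      `|(f (fun i => t i + h i) - P (fun i => t i + h i)) - (f t - P t)|
        <= C * (y * (x + y) ^+ 2)].
Proof.
move=> r0 Hf; pose p := r / 2; have p0 : 0 < p by rewrite divr_gt0.
have [cvp _] : cvgn (mpseries (fun al => `|c al|) (fun=> `|p|)) /\
    mpseries c (fun=> p) @ \oo --> f (fun=> p).
  by apply: Hf => _; rewrite gtr0_norm// /p ltr_pdivrMr// ltr_pMr// ltr1n.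
have [M HM] : exists M, forall m, mpseries (fun al => `|c al|) (fun=> p) m <= M.
  have /cvg_seq_bounded[M [_ HM]] := cvp; exists (M + 1) => m.
  have := HM (M + 1); rewrite ltrDl ltr01 => /(_ isT m Logic.I) /=.
  rewrite (gtr0_norm p0); exact: le_trans (ler_norm _).
pose mon a t := c (fun i => (a i : nat)) * \prod_i t i ^+ (a i : nat).
pose P t := \sum_(a : {ffun I -> 'I_3} | (\sum_i a i < 3)%N)
  c (fun i => (a i : nat)) * \prod_i t i ^+ (a i : nat).
pose g m t := \sum_(a : {ffun I -> 'I_m} | ~~ (\sum_i a i < 3)%N)
  c (fun i => (a i : nat)) * \prod_i t i ^+ (a i : nat).
have gE t m : (3 <= m)%N -> g m t = mpseries c t m - P t.
  move=> m3; rewrite /mpseries (bigID (fun a : {ffun I -> 'I_m} => (\sum_i a i < 3)%N))/=.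
  rewrite addrAC [X in X - _](_ : _ = P t) ?subrr ?add0r//.
  exact: (@low_degree_reindex _ _ (fun a => c a * \prod_i t i ^+ a i) _ m3).
have M0 : 0 <= M by apply: le_trans (HM 0%N); apply: sumr_ge0 => a _;
  rewrite mulr_ge0// prodr_ge0// => i _; rewrite exprn_ge0// ltW.
exists P, (M * (8 / p ^+ 3)), (p / 2); split.
- by apply: is_quadratic_sum => a a3; apply/is_quadraticZ/is_quadratic_monomial.
- by rewrite mulr_ge0// divr_ge0// exprn_ge0// ltW.
- by rewrite divr_gt0.
move=> t h x y tx hy x0 y0 xyp.
have xyr : x + y < r.
  apply: le_lt_trans xyp _; rewrite /p -mulrA -invfM ltr_pdivrMr// ltr_pMr//.
  by rewrite -natrM ltr1n.
have gcvg u : (forall i, `|u i| <= x + y) -> g^~ u @ \oo --> f u - P u.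
  move=> ur; have [|_ fu] := Hf u; first by move=> i; exact: le_lt_trans (ur i) xyr.
  apply: cvg_trans (cvgB fu (cvg_cst (P u))).
  by apply: near_eq_cvg; near=> m; rewrite gE//; near: m; exact: nbhs_infty_ge.
have thxy i : `|t i + h i| <= x + y by apply: le_trans (ler_normD _ _) _; rewrite lerD.
have txy i : `|t i| <= x + y by apply: le_trans (tx i) _; rewrite lerDl.
apply: (cvgr_to_le (cvg_norm (cvgB (gcvg _ thxy) (gcvg _ txy)))).
near=> m; rewrite [leLHS](_ : _ = `|g m (fun i => t i + h i) - g m t|)// /g -sumrB.
apply: le_trans (ler_norm_sum _ _ _) _.
pose K := 8 / p ^+ 3 * (y * (x + y) ^+ 2).
have K0 : 0 <= K by rewrite /K !mulr_ge0 ?invr_ge0 ?exprn_ge0 ?addr_ge0 ?(ltW p0).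
rewrite [leRHS](_ : _ = M * K); last by rewrite /K; ring.
apply: le_trans (_ : mpseries (fun al => `|c al|) (fun=> p) m * K <= _); last first.
  by rewrite ler_wpM2r.
rewrite /mpseries mulr_suml big_mkcond ler_sum//= => a _; case: ifP => [a3|_]; last first.
  rewrite mulr_ge0// mulr_ge0//; apply: prodr_ge0 => i _.
  by rewrite exprn_ge0// ltW.
rewrite -mulrBr normrM -mulrA ler_wpM2l// mulrC.
by apply: monomial_sub_tail; rewrite // leqNgt.
Unshelve. all: by end_near.
Qed.

End Jet.

(** * Coordinates on phase space and identification of differentials *)

Section PhaseSpace.
Context {R : realType} {N : nat}.
Local Notation idx := ('I_N.-1 + 'I_N.-1)%type.
Implicit Types (z u v w : phase R N).

Definition of_coord (t : idx -> R) : phase R N :=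
  (\row_k t (inl k), \row_k t (inr k)).

Lemma of_coordK t i : phase_coord (of_coord t) i = t i.
Proof. by case: i => i; rewrite /= mxE. Qed.

Lemma phase_coord_inj z w : (forall i, phase_coord z i = phase_coord w i) -> z = w.
Proof.
move: z w => [z1 z2] [w1 w2] H; congr pair; apply/rowP => k.
  exact: H (inl k).
exact: H (inr k).
Qed.

Lemma phase_coordD z w i : phase_coord (z + w) i = phase_coord z i + phase_coord w i.
Proof. by case: i => i; rewrite /= mxE. Qed.

Lemma phase_coordZ (k : R) z i : phase_coord (k *: z) i = k * phase_coord z i.
Proof. by case: i => i; rewrite /= mxE. Qed.

Lemma phase_coord0 i : phase_coord (0 : phase R N) i = 0.
Proof. by case: i => i; rewrite /= mxE. Qed.

Lemma phase_coordN z i : phase_coord (- z) i = - phase_coord z i.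
Proof. by case: i => i; rewrite /= mxE. Qed.

Lemma phase_norm_le z (x : R) : 0 <= x ->
  (forall i, `|phase_coord z i| <= x) -> `|z| <= x.
Proof.
move=> x0 zx; rewrite prod_normE ge_max; apply/andP; split.
  rewrite /Num.norm/= mx_normrE; apply: bigmax_le => // -[i j] _ /=.
  by rewrite ord1; exact: zx (inl j).
rewrite /Num.norm/= mx_normrE; apply: bigmax_le => // -[i j] _ /=.
by rewrite ord1; exact: zx (inr j).
Qed.

Lemma phase_coord_norm z i : `|phase_coord z i| <= `|z|.
Proof.
rewrite prod_normE le_max; case: i => i; apply/orP; [left|right];
  rewrite {2}/Num.norm/= mx_normrE;
  exact: (le_bigmax _ (fun j : 'I_1 * 'I_N.-1 => `|_ j.1 j.2|) (0, i)).
Qed.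

Definition lmap (b : idx -> idx -> R) (u : phase R N) : phase R N :=
  of_coord (fun i => \sum_j b i j * phase_coord u j).

Lemma lmap_is_linear b : linear (lmap b).
Proof.
move=> k u v; apply: phase_coord_inj => i.
rewrite phase_coordD phase_coordZ !of_coordK mulr_sumr -big_split/=.
by apply: eq_bigr => j _; rewrite phase_coordD phase_coordZ; ring.
Qed.

HB.instance Definition _ b := GRing.isLinear.Build R (phase R N) (phase R N) *:%R
  (lmap b) (@lmap_is_linear b).

Lemma lmap_continuous b : continuous (lmap b).
Proof.
apply/linear_bounded_continuous/linear_boundedP.
pose M := \sum_i \sum_j `|b i j|.
near=> r => u; apply: phase_norm_le.
  rewrite mulr_ge0//; near: r; exact: nbhs_pinfty_ge.
move=> i; rewrite of_coordK; apply: le_trans (ler_norm_sum _ _ _) _.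
apply: le_trans (_ : M * `|u| <= _).
  rewrite [M](bigD1 i)//= mulrDl -[leLHS]addr0 lerD//.
    rewrite mulr_suml; apply: ler_sum => j _.
    by rewrite normrM ler_wpM2l// phase_coord_norm.
  by rewrite mulr_ge0// sumr_ge0// => j _; rewrite sumr_ge0.
by rewrite ler_wpM2r//; near: r; exact: nbhs_pinfty_ge.
Unshelve. all: by end_near.
Qed.

(** An error quadratic in the coordinates is an o(h), so uniqueness of the differential identifies
    ['d f a]. *)
Lemma diff_of_bound (f : phase R N -> phase R N) a b (C d : R) : 0 < d ->
  (forall h (x : R), (forall i, `|phase_coord h i| <= x) -> 0 <= x -> x <= d ->
     forall i, `|phase_coord (f (a + h)) i - phase_coord (f a) i
                 - \sum_j b i j * phase_coord h j| <= C * x ^+ 2) ->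
  'd f a = lmap b :> (phase R N -> phase R N).
Proof.
move=> d0 H; apply: diff_unique; first exact: lmap_continuous.
apply/eqaddoP => e e0.
have dn := @nbhs0_le _ (phase R N) _ d0.
have en : \forall h \near (0 : phase R N), `|h| <= e / (`|C| + 1).
  by apply: nbhs0_le; rewrite divr_gt0// ltr_wpDl.
near=> h.
apply: phase_norm_le; first by rewrite mulr_ge0// ltW.
move=> i; rewrite (_ : phase_coord _ i = phase_coord (f (a + h)) i - phase_coord (f a) i
   - \sum_j b i j * phase_coord h j); last first.
  rewrite [LHS](_ : _ = phase_coord (f (h + a) - (f a + lmap b h)) i)//.
  by rewrite phase_coordD phase_coordN phase_coordD of_coordK opprD addrA [h + a]addrC.
have hd : `|h| <= d by near: h.
apply: le_trans (H h `|h| _ _ _ i) _ => //; first by move=> j; exact: phase_coord_norm.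
rewrite expr2 mulrA ler_wpM2r//.
have : `|h| <= e / (`|C| + 1) by near: h.
rewrite ler_pdivlMr ?ltr_wpDl// => he.
apply: le_trans he; rewrite mulrC ler_wpM2l//.
by apply: le_trans (ler_norm C) _; rewrite lerDl.
Unshelve. all: by end_near.
Qed.

End PhaseSpace.

Section SecondJet.
Context {R : realType} {N : nat}.
Local Notation idx := ('I_N.-1 + 'I_N.-1)%type.
Implicit Types (z u v w h : phase R N).

Definition bform (q : idx -> idx -> R) u v : R :=
  \sum_j \sum_k q j k * (phase_coord u j * phase_coord v k).

Lemma bformD q u v w : bform q u (v + w) = bform q u v + bform q u w.
Proof.
rewrite -big_split; apply: eq_bigr => j _; rewrite -big_split; apply: eq_bigr => k _ /=.
by rewrite phase_coordD; ring.
Qed.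

Lemma bformZ q u (a : R) v : bform q u (a *: v) = a * bform q u v.
Proof.
rewrite mulr_sumr; apply: eq_bigr => j _; rewrite mulr_sumr; apply: eq_bigr => k _ /=.
by rewrite phase_coordZ; ring.
Qed.

Lemma bformC q u v : (forall j k, q j k = q k j) -> bform q u v = bform q v u.
Proof.
move=> qC; rewrite /bform exchange_big; apply: eq_bigr => j _; apply: eq_bigr => k _.
by rewrite qC; ring.
Qed.

Lemma bform_le q u v (x y : R) :
  (forall i, `|phase_coord u i| <= x) -> (forall i, `|phase_coord v i| <= y) ->
  `|bform q u v| <= (\sum_j \sum_k `|q j k|) * (x * y).
Proof.
move=> ux vy; rewrite /bform mulr_suml; apply: le_trans (ler_norm_sum _ _ _) _.
apply: ler_sum => j _; rewrite mulr_suml; apply: le_trans (ler_norm_sum _ _ _) _.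
by apply: ler_sum => k _; rewrite !normrM ler_wpM2l// ler_pM.
Qed.

Definition dot (l : idx -> R) h : R := \sum_j l j * phase_coord h j.

Lemma dotD l u v : dot l (u + v) = dot l u + dot l v.
Proof. by rewrite -big_split; apply: eq_bigr => j _ /=; rewrite phase_coordD mulrDr. Qed.

Lemma dotZ l (a : R) u : dot l (a *: u) = a * dot l u.
Proof. by rewrite mulr_sumr; apply: eq_bigr => j _ /=; rewrite phase_coordZ mulrCA. Qed.

(** The base point [a + z] varies while the constants do not depend on [z]: the term
    [2 * bform q z h] displays how the linear part of the increment changes with [z], that is, the
    second derivative. *)
Lemma analytic_jet (f : phase R N -> R) a : analytic_at f a ->
  exists (l : idx -> R) (q : idx -> idx -> R) (C d : R),
  [/\ forall j k, q j k = q k j, 0 <= C, 0 < d &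
    forall z h (x y : R), (forall i, `|phase_coord z i| <= x) ->
      (forall i, `|phase_coord h i| <= y) -> 0 <= x -> 0 <= y -> x + y <= d ->
      `|f (a + z + h) - f (a + z) - (dot l h + 2 * bform q z h + bform q h h)|
        <= C * (y * (x + y) ^+ 2)].
Proof.
move=> [c [r [r0 Hf]]].
have [|P [C [d [[c0 [l [q PE]]] C0 d0 H]]]] :=
    @mpseries_jet R _ c (fun t => f (a + of_coord t)) r r0.
  move=> t tr; have := Hf (a + of_coord t).
  have tE : (fun i => phase_coord (a + of_coord t) i - phase_coord a i) = t.
    by apply/funext => i; rewrite phase_coordD of_coordK addrC addKr.
  have tEn : (fun i => `|phase_coord (a + of_coord t) i - phase_coord a i|) = (fun i => `|t i|).
    by apply/funext => i; rewrite phase_coordD of_coordK addrC addKr.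
  rewrite /= tEn tE; apply => i.
  by rewrite phase_coordD of_coordK addrC addKr.
(* Symmetrization preserves the quadratic form and merges the two cross terms of [P (z + h)] into
   twice one of them. *)
pose q' j k := (q j k + q k j) / 2.
exists l, q', C, d; split => //; first by move=> j k; rewrite /q' addrC.
move=> z h x y zx hy x0 y0 xyd.
have := H (phase_coord z) (phase_coord h) _ _ zx hy x0 y0 xyd.
have coordK w : of_coord (phase_coord w) = w.
  by apply: phase_coord_inj => i; rewrite of_coordK.
have -> : (fun i => phase_coord z i + phase_coord h i) = phase_coord (z + h).
  by apply/funext => i; rewrite phase_coordD.
rewrite !coordK addrA.
have PE' w : P (phase_coord w) = c0 + dot l w + bform q' w w.
  rewrite PE; congr (_ + _); rewrite -[LHS]mul1r -[1](_ : 2^-1 * (1 + 1) = 1); last by field.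
  rewrite -mulrA mulrDl !mul1r [X in _ + X]exchange_big -big_split mulr_sumr.
  apply: eq_bigr => j _; rewrite -big_split mulr_sumr; apply: eq_bigr => k _ /=.
  by rewrite /q'; field.
rewrite !PE' dotD bformD (bformC (z + h)) ?bformD; last by move=> j k; rewrite /q' addrC.
rewrite (bformC (z + h)) ?bformD; last by move=> j k; rewrite /q' addrC.
rewrite (@bformC _ h z); last by move=> j k; rewrite /q' addrC.
by congr (`|_| <= _); ring.
Qed.

Lemma real_analytic_jet (F : phase R N -> phase R N) a : real_analytic F ->
  exists (b : idx -> idx -> R) (q : idx -> idx -> idx -> R) (C d : R),
  [/\ forall i j k, q i j k = q i k j, 0 <= C, 0 < d &
    forall z h (x y : R), (forall i, `|phase_coord z i| <= x) ->
      (forall i, `|phase_coord h i| <= y) -> 0 <= x -> 0 <= y -> x + y <= d ->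
      forall i, `|phase_coord (F (a + z + h)) i - phase_coord (F (a + z)) i
          - (dot (b i) h + 2 * bform (q i) z h + bform (q i) h h)|
        <= C * (y * (x + y) ^+ 2)].
Proof.
move=> HF.
have /choice[b /choice[q /choice[C /choice[d H]]]] := fun i => analytic_jet (HF a i).
exists b, q, (\sum_i C i), (\big[Order.min/1]_i d i); split.
- by move=> i j k; have [->] := H i.
- by apply: sumr_ge0 => i _; have [] := H i.
- by apply: lt_bigmin => // i _; have [] := H i.
move=> z h x y zx hy x0 y0 xyd i; have [_ C0 d0 Hi] := H i.
apply: le_trans (Hi _ _ _ _ zx hy x0 y0 _) _.
  by apply: le_trans xyd _; exact: bigmin_le.
rewrite ler_wpM2r//; first by rewrite mulr_ge0// exprn_ge0// addr_ge0.
rewrite [leRHS](bigD1 i)//= lerDl sumr_ge0// => j _.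
by have [] := H j.
Qed.

Lemma jet_diff (F : phase R N -> phase R N) a (b : idx -> idx -> R)
    (q : idx -> idx -> idx -> R) (C d : R) : 0 <= C -> 0 < d ->
  (forall z h (x y : R), (forall i, `|phase_coord z i| <= x) ->
      (forall i, `|phase_coord h i| <= y) -> 0 <= x -> 0 <= y -> x + y <= d ->
      forall i, `|phase_coord (F (a + z + h)) i - phase_coord (F (a + z)) i
          - (dot (b i) h + 2 * bform (q i) z h + bform (q i) h h)|
        <= C * (y * (x + y) ^+ 2)) ->
  exists K : R, forall h (x : R), (forall i, `|phase_coord h i| <= x) -> 0 <= x -> x <= Order.min 1 d ->
     forall i, `|phase_coord (F (a + h)) i - phase_coord (F a) i - dot (b i) h| <= K * x ^+ 2.
Proof.
move=> C0 d0 H.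
exists (C + \sum_i \sum_j \sum_k `|q i j k|) => h x hx x0; rewrite le_min => /andP[x1 xd] i.
have b0 : bform (q i) 0 h = 0.
  rewrite /bform big1// => j _; rewrite big1// => k _.
  by rewrite phase_coord0 mul0r mulr0.
have z0 (j : idx) : `|phase_coord (0 : phase R N) j| <= 0 by rewrite phase_coord0 normr0.
have xd' : 0 + x <= d by rewrite add0r.
have := H _ h _ x z0 hx (lexx 0) x0 xd' i; rewrite addr0 b0 mulr0 addr0 => H0.
rewrite [X in `|X|](_ : _ = phase_coord (F (a + h)) i - phase_coord (F a) i -
  (dot (b i) h + bform (q i) h h) + bform (q i) h h); last by ring.
apply: le_trans (ler_normD _ _) _; rewrite mulrDl lerD//.
  apply: le_trans H0 _.
  by rewrite add0r ler_wpM2l// -[leRHS]mul1r ler_wpM2r// exprn_ge0.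
apply: le_trans (bform_le _ hx hx) _; rewrite -expr2 ler_wpM2r ?sqr_ge0//.
rewrite [leRHS](bigD1 i)//= lerDl sumr_ge0// => i' _; rewrite sumr_ge0// => j _.
by rewrite sumr_ge0.
Qed.

(** Limit as [s] tends to 0 from the right; [K] may depend on everything but [s], and drops out. *)
Lemma le_of_small (A K c U x d : R) : 0 < d ->
  (forall s, 0 < s -> s <= d -> A <= K * s + c * (x + s * U) ^+ 2) -> A <= c * x ^+ 2.
Proof.
move=> d0 H.
have : (fun s : R => K * s + c * (x + s * U) ^+ 2) @ (0 : R)^'+ --> c * x ^+ 2.
  rewrite [X in _ --> X](_ : _ = K * 0 + c * (x + 0 * U) ^+ 2); last by ring.
  apply: cvgD.
    by apply: cvgM; [exact: cvg_cst|exact: cvg_within].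
  apply: cvgM; first exact: cvg_cst.
  rewrite !expr2; apply: cvgM; apply: cvgD; try exact: cvg_cst;
    by apply: cvgM; [exact: cvg_within|exact: cvg_cst].
move/cvgr_to_ge; apply; near=> s; apply: H.
  by near: s; exact: nbhs_right_gt.
by near: s; exact: nbhs_right_le.
Unshelve. all: by end_near.
Qed.

End SecondJet.

(** * The second differential of a real analytic map at the origin *)

Section Diff2.
Context {R : realType} {N : nat}.
Local Notation idx := ('I_N.-1 + 'I_N.-1)%type.
Implicit Types (z u v w h : phase R N).

Lemma diff_of_jet_bound (F : phase R N -> phase R N) a (b : idx -> idx -> R) (K d : R) :
  0 < d ->
  (forall h (x : R), (forall i, `|phase_coord h i| <= x) -> 0 <= x -> x <= d ->
     forall i, `|phase_coord (F (a + h)) i - phase_coord (F a) i - dot (b i) h| <= K * x ^+ 2) ->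
  forall h i, phase_coord ('d F a h) i = dot (b i) h.
Proof. by move=> d0 H h i; rewrite (diff_of_bound d0 H) of_coordK. Qed.

(** Two expansions of F (z + s u) - F z are compared: the one around 0 has an error uniform in z,
    and the one around z has ['d F z u] as its linear term in s. Dividing by s and letting s tend to
    0 gives ['d F z u] up to O(|z|^2), hence both the differentiability of this function of z at 0
    and the value of [diff2]. *)
Lemma second_jet (F : phase R N -> phase R N) : real_analytic F ->
  exists beta : idx -> idx -> idx -> R,
  [/\ forall i j k, beta i j k = beta i k j,
      forall u v i, phase_coord (diff2 F 0 u v) i = bform (beta i) u v,
      exists C d : R, 0 < d /\ forall h (x : R), (forall i, `|phase_coord h i| <= x) -> 0 <= x -> x <= d ->
        forall i, `|phase_coord (F h) i - phase_coord (F 0) i - phase_coord ('d F 0 h) i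
          - bform (beta i) h h / 2| <= C * x ^+ 3 &
      forall u, exists C d : R, 0 < d /\ forall h (x : R), (forall i, `|phase_coord h i| <= x) ->
        0 <= x -> x <= d -> forall i,
        `|phase_coord ('d F h u) i - phase_coord ('d F 0 u) i - bform (beta i) u h| <= C * x ^+ 2].
Proof.
move=> HF; have [b [q [C [d [qC C0 d0 H]]]]] := real_analytic_jet 0 HF.
have z0 (j : idx) : `|phase_coord (0 : phase R N) j| <= 0 by rewrite phase_coord0 normr0.
have dF0 u i : phase_coord ('d F 0 u) i = dot (b i) u.
  have [K HK] := jet_diff C0 d0 H.
  have m0 : 0 < Order.min 1 d by rewrite lt_min ltr01.
  exact: (diff_of_jet_bound m0 HK).
(* The cross term of the jet is [2 * bform (q i) z h]: the second derivative is twice the quadratic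
   coefficient. *)
pose beta i j k := 2 * q i j k.
have betaE i u v : bform (beta i) u v = 2 * bform (q i) u v.
  rewrite mulr_sumr; apply: eq_bigr => j _; rewrite mulr_sumr; apply: eq_bigr => k _.
  by rewrite /beta -mulrA.
have betaC i j k : beta i j k = beta i k j by rewrite /beta qC.
have dFz u : exists C d : R, 0 < d /\ forall h (x : R), (forall i, `|phase_coord h i| <= x) ->
        0 <= x -> x <= d -> forall i,
        `|phase_coord ('d F h u) i - phase_coord ('d F 0 u) i - bform (beta i) u h| <= C * x ^+ 2.
  exists (C * `|u|), (d / 2); split; first by rewrite divr_gt0.
  move=> z x zx x0 xd i; rewrite [X in _ - X - _](dF0 u i) betaE (@bformC _ _ (q i) u z)//.
  (* The constants of this expansion depend on [z], which is harmless: [s] tends to 0 with [z]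
     fixed. *)
  have [b' [q' [C' [d' [_ C'0 d'0 H']]]]] := real_analytic_jet z HF.
  have [K HK] := jet_diff C'0 d'0 H'.
  have min0 : 0 < Order.min 1 d' by rewrite lt_min ltr01.
  rewrite [X in X - _ - _](diff_of_jet_bound min0 HK u i).
  set U := `|u|; have U0 : 0 <= U by exact: normr_ge0.
  pose D := Order.min (d / 2) (Order.min 1 d') / (U + 1).
  have U1 : 0 < U + 1 by apply: lt_le_trans ltr01 _; rewrite lerDr.
  apply: (@le_of_small _ _ (K * U ^+ 2 + `|bform (q i) u u|) _ U _ D).
    by rewrite divr_gt0// lt_min min0 divr_gt0.
  move=> s s0; rewrite ler_pdivlMr// le_min => /andP[sd smin].
  have sU : s * U <= s * (U + 1) by rewrite ler_wpM2l ?(ltW s0)// lerDl.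
  have suU j : `|phase_coord (s *: u) j| <= s * U.
    by rewrite phase_coordZ normrM gtr0_norm// ler_wpM2l ?(ltW s0)// phase_coord_norm.
  have sU0 : 0 <= s * U by rewrite mulr_ge0// ltW.
  have H1 := HK (s *: u) (s * U) suU sU0 (le_trans sU smin) i.
  have xsd : x + s * U <= d.
    by rewrite [leRHS]splitr lerD// (le_trans sU sd).
  have := H z (s *: u) x (s * U) zx suU x0 sU0 xsd i.
  rewrite add0r !bformZ (@bformC _ _ (q i) (s *: u) u)// !bformZ dotZ => H2.
  move: H1; rewrite dotZ => H1.
  rewrite -(@ler_pM2l _ s)// -{1}(gtr0_norm s0) -normrM.
  set A := phase_coord (F (z + _)) i in H1 H2; set B := phase_coord (F z) i in H1 H2.
  set l' := dot (b' i) u in H1 *; set l := dot (b i) u in H2 *.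
  set quz := bform (q i) z u in H2 *; set quu := bform (q i) u u in H2 *.
  rewrite [X in `|X|](_ : _ = (A - B - (s * l + 2 * (s * quz) + s * (s * quu)))
     - (A - B - s * l') + s * (s * quu)); last by ring.
  apply: le_trans (ler_normD _ _) _.
  apply: le_trans (lerD (ler_normB _ _) (lexx _)) _.
  apply: le_trans (lerD (lerD H2 H1) (lexx _)) _.
  rewrite !normrM (gtr0_norm s0).
  by rewrite le_eqVlt; apply/orP; left; apply/eqP; ring.
exists beta; split => //.
- move=> u v i; rewrite /diff2.
  have [C' [d' [d'0 H']]] := dFz u.
  rewrite (@diff_of_jet_bound _ _ (fun i j => \sum_k beta i j k * phase_coord u k) C' d' d'0).
    rewrite bformC//; apply: eq_bigr => j _; rewrite mulr_suml; apply: eq_bigr => k _.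
    by ring.
  move=> h x hx x0 xd j; rewrite add0r.
  rewrite [dot _ _](_ : _ = bform (beta j) u h); first exact: H'.
  rewrite bformC//; apply: eq_bigr => j' _; rewrite mulr_suml; apply: eq_bigr => k _.
  by ring.
- exists C, d; split => // h x hx x0 xd i.
  have xd' : 0 + x <= d by rewrite add0r.
  have b0 : bform (q i) 0 h = 0.
    rewrite /bform big1// => j _; rewrite big1// => k _.
    by rewrite phase_coord0 mul0r mulr0.
  have := H _ h _ x z0 hx (lexx 0) x0 xd' i; rewrite !addr0 !add0r b0 mulr0 addr0 -exprS.
  apply: le_trans; rewrite [X in _ - X - _](dF0 h i) betaE le_eqVlt; apply/orP; left; apply/eqP.
  by congr (`|_|); field.
Qed.

End Diff2.

(** * Fourier orthogonality and Toda coordinates *)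

Section TrigSums.
Context {R : realType}.
Implicit Types (x y phi : R) (M N k l : nat).

Lemma sum_cos_eq0 phi M : sin (phi / 2) != 0 -> cos (M%:R * phi) = 1 ->
  sin (M%:R * phi) = 0 -> \sum_(j < M) cos (j%:R * phi) = 0.
Proof.
move=> s0 cM sM; have s2 : 2 * sin (phi / 2) != 0 by rewrite mulf_neq0// pnatr_eq0.
apply: (mulfI s2).
(* After multiplication by 2 sin(phi/2), each summand is a difference of two consecutive values of
   [f], and the sum telescopes. *)
pose f (j : nat) : R := sin (j%:R * phi - phi / 2).
rewrite mulr0 mulr_sumr (eq_bigr (fun j : 'I_M => f j.+1 - f j)); last first.
  move=> j _; rewrite /f (_ : j.+1%:R * phi - phi / 2 = j%:R * phi + phi / 2).
    by rewrite sinB sinD; ring.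
  by rewrite -natr1; field.
rewrite -(big_mkord xpredT (fun j => f j.+1 - f j)) telescope_sumr// /f.
by rewrite !sinB cM sM !mul0r sin0 cos0; ring.
Qed.

Lemma sum_sin_eq0 phi M : cos (M%:R * phi) = 1 ->
  sin (M%:R * phi) = 0 -> \sum_(j < M) sin (j%:R * phi) = 0.
Proof.
move=> cM sM; have [s0|s0] := eqVneq (sin (phi / 2)) 0.
  rewrite big1// => j _; elim: (j : nat) => [|n IH]; first by rewrite mul0r sin0.
  rewrite -natr1 mulrDl mul1r sinD IH mul0r add0r [phi in sin phi]splitr sinD s0.
  by rewrite mul0r mulr0 addr0 mulr0.
have s2 : 2 * sin (phi / 2) != 0 by rewrite mulf_neq0// pnatr_eq0.
apply: (mulfI s2).
pose f (j : nat) : R := - cos (j%:R * phi - phi / 2).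
rewrite mulr0 mulr_sumr (eq_bigr (fun j : 'I_M => f j.+1 - f j)); last first.
  move=> j _; rewrite /f (_ : j.+1%:R * phi - phi / 2 = j%:R * phi + phi / 2).
    by rewrite cosB cosD; ring.
  by rewrite -natr1; field.
rewrite -(big_mkord xpredT (fun j => f j.+1 - f j)) telescope_sumr// /f.
by rewrite !cosB cM sM !mul0r sin0 cos0; ring.
Qed.

Lemma cos_nat2pi k : cos (k%:R * (2 * pi)) = 1 :> R.
Proof.
elim: k => [|k IH]; first by rewrite mul0r cos0.
by rewrite -natr1 mulrDl mul1r [2 * _]mulr_natl cosD2pi -[_ *+ 2]mulr_natl.
Qed.

Lemma sin_nat2pi k : sin (k%:R * (2 * pi)) = 0 :> R.
Proof.
elim: k => [|k IH]; first by rewrite mul0r sin0.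
by rewrite -natr1 mulrDl mul1r [2 * _]mulr_natl sinD2pi -[_ *+ 2]mulr_natl.
Qed.

Lemma sin_neq0 x : - pi < x < pi -> x != 0 -> sin x != 0.
Proof.
move=> /andP[xl xr]; rewrite neq_lt => /orP[x0|x0].
  by rewrite -[x]opprK sinN oppr_eq0 gt_eqF// sin_gt0_pi// oppr_gt0 x0 ltrNl.
by rewrite gt_eqF// sin_gt0_pi// x0.
Qed.

End TrigSums.

Section Orthogonality.
Context {R : realType}.
Implicit Types (phi psi : R) (M N k l : nat).

Definition period M phi : Prop := cos (M%:R * phi) = 1 /\ sin (M%:R * phi) = 0.

Lemma periodD M phi psi : period M phi -> period M psi -> period M (phi + psi).
Proof.
move=> [c1 s1] [c2 s2]; split; rewrite mulrDr.
  by rewrite cosD c1 s1 c2 s2; ring.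
by rewrite sinD c1 s1 c2 s2; ring.
Qed.

Lemma periodN M phi : period M phi -> period M (- phi).
Proof. by move=> [c s]; split; rewrite mulrN ?cosN// sinN s oppr0. Qed.

Lemma sum_cosM_sin M phi psi : period M phi -> period M psi ->
  \sum_(j < M) cos (j%:R * phi) * sin (j%:R * psi) = 0.
Proof.
move=> Hphi Hpsi; have [c1 s1] := periodD Hphi Hpsi.
have [c2 s2] := periodD Hphi (periodN Hpsi).
have := sum_sin_eq0 c1 s1; have := sum_sin_eq0 c2 s2 => S2 S1.
rewrite (eq_bigr (fun j : 'I_M => 2^-1 * (sin (j%:R * (phi + psi)) - sin (j%:R * (phi - psi))))).
  by rewrite -mulr_sumr sumrB S1 S2 subrr mulr0.
by move=> j _; rewrite [_ * (phi + psi)]mulrDr [_ * (phi - psi)]mulrBr sinB sinD; field.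
Qed.

Lemma sum_cosD_sin M phi psi : period M phi -> period M psi -> sin ((phi - psi) / 2) != 0 ->
  \sum_(j < M) (cos (j%:R * phi) * cos (j%:R * psi) + sin (j%:R * phi) * sin (j%:R * psi)) = 0.
Proof.
move=> Hphi Hpsi s0; have [c1 s1] := periodD Hphi (periodN Hpsi).
rewrite -[RHS](sum_cos_eq0 s0 c1 s1); apply: eq_bigr => j _.
by rewrite mulrBr cosB.
Qed.

Lemma sum_cosB_sin M phi psi : period M phi -> period M psi -> sin ((phi + psi) / 2) != 0 ->
  \sum_(j < M) (cos (j%:R * phi) * cos (j%:R * psi) - sin (j%:R * phi) * sin (j%:R * psi)) = 0.
Proof.
move=> Hphi Hpsi s0; have [c1 s1] := periodD Hphi Hpsi.
rewrite -[RHS](sum_cos_eq0 s0 c1 s1); apply: eq_bigr => j _.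
by rewrite mulrDr cosD.
Qed.

Definition theta N k : R := k%:R * (2 * pi) / N%:R.

Lemma period_theta N k : (0 < N)%N -> period N (theta N k).
Proof.
move=> N0; rewrite /period (_ : N%:R * _ = k%:R * (2 * pi)).
  by rewrite cos_nat2pi sin_nat2pi.
by rewrite /theta mulrC divfK// pnatr_eq0 -lt0n.
Qed.

Lemma omega_gt0 N k : (0 < k < N)%N -> 0 < omega N k :> R.
Proof.
move=> /andP[k0 kN]; rewrite mulr_gt0// sin_gt0_pi//.
have N0 : (0 : R) < N%:R by rewrite ltr0n (leq_trans _ kN).
apply/andP; split; first by rewrite divr_gt0// mulr_gt0 ?pi_gt0// ltr0n.
by rewrite ltr_pdivrMr// mulrC ltr_pM2l ?pi_gt0// ltr_nat.
Qed.

Lemma sin_half_theta_sub_neq0 N k l : (0 < k < N)%N -> (0 < l < N)%N -> k != l ->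
  sin ((theta N k - theta N l) / 2) != 0 :> R.
Proof.
move=> /andP[k0 kN] /andP[l0 lN] kl.
have N0 : (0 : R) < N%:R by rewrite ltr0n (leq_trans _ kN).
rewrite (_ : _ / 2 = (k%:R - l%:R) * pi / N%:R); last first.
  by rewrite /theta; field; rewrite gt_eqF.
apply: sin_neq0.
  rewrite ltr_pdivlMr// ltr_pdivrMr// mulNr -mulrN ![pi * _]mulrC !ltr_pM2r ?pi_gt0//.
  move: k0 kN l0 lN; rewrite -!(ltr_nat R) => *; apply/andP; split; lra.
by rewrite !mulf_neq0 ?invr_eq0 ?(gt_eqF (pi_gt0 R)) ?(gt_eqF N0)// subr_eq0 eqr_nat.
Qed.

Lemma sin_half_theta_add_neq0 N k l : (0 < k < N)%N -> (0 < l < N)%N -> (k + l != N)%N ->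
  sin ((theta N k + theta N l) / 2) != 0 :> R.
Proof.
move=> /andP[k0 kN] /andP[l0 lN] kl.
have N0 : (0 : R) < N%:R by rewrite ltr0n (leq_trans _ kN).
(* The angle (k + l) pi / N lies strictly between 0 and 2 pi. Shifted by pi it falls strictly
   between - pi and pi, where the sine vanishes only at 0, that is for k + l = N. *)
rewrite (_ : _ / 2 = (k%:R + l%:R - N%:R) * pi / N%:R + pi); last first.
  by rewrite /theta; field; rewrite gt_eqF.
rewrite sinDpi oppr_eq0; apply: sin_neq0.
  rewrite ltr_pdivlMr// ltr_pdivrMr// mulNr -mulrN ![pi * _]mulrC !ltr_pM2r ?pi_gt0//.
  move: k0 kN l0 lN; rewrite -!(ltr_nat R) => *; apply/andP; split; lra.
by rewrite !mulf_neq0 ?invr_eq0 ?(gt_eqF (pi_gt0 R)) ?(gt_eqF N0)// subr_eq0 -natrD eqr_nat.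
Qed.

Lemma omega_sub N k l : (0 < k < N)%N -> (k + l = N)%N -> omega N k = omega N l :> R.
Proof.
move=> /andP[k0 kN] kl; have N0 : (N%:R : R) != 0 by rewrite pnatr_eq0 -lt0n (leq_trans _ kN).
rewrite /omega (_ : k%:R * pi / N%:R = pi - l%:R * pi / N%:R).
  by rewrite sinB sinpi cospi; ring.
by rewrite -kl natrD; field; rewrite -natrD kl.
Qed.

Lemma sin_theta_half N k : (0 < N)%N -> 2 * sin (theta N k / 2) = omega N k :> R.
Proof.
by move=> N0; rewrite /omega /theta; congr (_ * sin _); field; rewrite pnatr_eq0 -lt0n.
Qed.

(** The summand is (x + y)/2 times the cosine of the difference of the phases plus (x - y)/2 times
    the cosine of their sum. On integer sites the second sum survives for k + l = N (aliasing),
    where the hypothesis makes its coefficient zero. The weights [omega N l] and [omega N k] qualify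
    by [omega_sub]. *)
Lemma dft_orthogonality N k l (x y : R) : (0 < k < N)%N -> (0 < l < N)%N ->
  ((k + l)%N = N -> x = y) ->
  \sum_(j < N) (x * (cos (j%:R * theta N k) * cos (j%:R * theta N l))
     + y * (sin (j%:R * theta N k) * sin (j%:R * theta N l)))
  = N%:R * ((x + y) / 2) * (k == l)%:R.
Proof.
move=> kN lN xy; have N0 : (0 < N)%N by case/andP: kN => _; exact: leq_trans.
rewrite (eq_bigr (fun j : 'I_N =>
  (x + y) / 2 * (cos (j%:R * theta N k) * cos (j%:R * theta N l)
     + sin (j%:R * theta N k) * sin (j%:R * theta N l)) +
  (x - y) / 2 * (cos (j%:R * theta N k) * cos (j%:R * theta N l)
     - sin (j%:R * theta N k) * sin (j%:R * theta N l)))); last by move=> j _; field.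
rewrite big_split -!mulr_sumr/=.
rewrite [X in _ + X](_ : _ = 0) ?addr0; last first.
  have [/xy ->|kl] := eqVneq (k + l)%N N; first by rewrite subrr !mul0r.
  by rewrite (sum_cosB_sin (period_theta _ N0) (period_theta _ N0)) ?mulr0//
    sin_half_theta_add_neq0.
have [<-|kl] := eqVneq k l; last first.
  by rewrite (sum_cosD_sin (period_theta _ N0) (period_theta _ N0)) ?mulr0//
    sin_half_theta_sub_neq0.
rewrite (eq_bigr (fun=> 1)) ?sumr_const ?card_ord; last by move=> j _; rewrite -!expr2 cos2Dsin2.
by rewrite /= mulr1; field.
Qed.

Lemma dft_orthogonality_cos N k l : (0 < k < N)%N -> (0 < l < N)%N ->
  \sum_(j < N) (omega N l * (cos (j%:R * theta N k) * cos (j%:R * theta N l))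
     + omega N k * (sin (j%:R * theta N k) * sin (j%:R * theta N l)))
  = N%:R * omega N k * (k == l)%:R :> R.
Proof.
move=> kN lN; rewrite dft_orthogonality// => [|/(omega_sub kN) ->//].
by case: eqVneq => [->|_]; [field|rewrite !mulr0].
Qed.

Lemma dft_orthogonality_sin N k l : (0 < k < N)%N -> (0 < l < N)%N ->
  \sum_(j < N) (omega N l * (sin (j%:R * theta N k) * sin (j%:R * theta N l))
     + omega N k * (cos (j%:R * theta N k) * cos (j%:R * theta N l)))
  = N%:R * omega N k * (k == l)%:R :> R.
Proof.
move=> kN lN; under eq_bigr do rewrite addrC.
rewrite dft_orthogonality// => [|/(omega_sub kN) ->//].
by case: eqVneq => [->|_]; [field|rewrite !mulr0].
Qed.

(* On the 2N half-integer sites j/2, all the modes are pairwise orthogonal: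
   the aliasing of the modes k and N - k disappears. *)
Lemma half_step_orthogonality N k l : (0 < k < N)%N -> (0 < l < N)%N ->
  [/\ \sum_(j < N.*2) cos (j%:R / 2 * theta N k) * cos (j%:R / 2 * theta N l)
        = N%:R * (k == l)%:R :> R,
      \sum_(j < N.*2) sin (j%:R / 2 * theta N k) * sin (j%:R / 2 * theta N l)
        = N%:R * (k == l)%:R :> R &
      \sum_(j < N.*2) cos (j%:R / 2 * theta N k) * sin (j%:R / 2 * theta N l) = 0 :> R].
Proof.
move=> kN lN; have N0 : (0 < N)%N by case/andP: kN => _; exact: leq_trans.
have hE i (j : 'I_N.*2) : j%:R / 2 * theta N i = j%:R * (theta N i / 2) :> R by ring.
have P i : period N.*2 (theta N i / 2).
  have [c s] := period_theta i N0; rewrite /period -mul2n natrM.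
  by rewrite (_ : _ * (theta N i / 2) = N%:R * theta N i)//; field.
have Sp : sin ((theta N k / 2 + theta N l / 2) / 2) != 0.
  apply: lt0r_neq0; apply: sin_gt0_pi.
  move: kN lN => /andP[k0 kN] /andP[l0 lN].
  have NR : (0 : R) < N%:R by rewrite ltr0n.
  rewrite (_ : _ / 2 = (k%:R + l%:R) / 2 * pi / N%:R); last first.
    by rewrite /theta; field; rewrite gt_eqF.
  apply/andP; split.
    by rewrite divr_gt0// mulr_gt0 ?pi_gt0// divr_gt0// addr_gt0 ?ltr0n.
  rewrite ltr_pdivrMr// mulrC ltr_pM2l ?pi_gt0//.
  by move: kN lN; rewrite -!(ltr_nat R); lra.
have Sm : k != l -> sin ((theta N k / 2 - theta N l / 2) / 2) != 0.
  move=> kl; have NR : (0 : R) < N%:R by rewrite ltr0n.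
  rewrite (_ : _ / 2 = (k%:R - l%:R) / 2 * pi / N%:R); last first.
    by rewrite /theta; field; rewrite gt_eqF.
  move: kN lN => /andP[k0 kN] /andP[l0 lN]; apply: sin_neq0.
    rewrite ltr_pdivlMr// ltr_pdivrMr// mulNr -mulrN ![pi * _]mulrC !ltr_pM2r ?pi_gt0//.
    by move: k0 kN l0 lN; rewrite -!(ltr_nat R) => *; apply/andP; split; lra.
  by rewrite !mulf_neq0 ?invr_eq0 ?(gt_eqF (pi_gt0 R)) ?(gt_eqF NR) ?pnatr_eq0// subr_eq0 eqr_nat.
have HB := sum_cosB_sin (P k) (P l) Sp.
have HD : \sum_(j < N.*2) (cos (j%:R * (theta N k / 2)) * cos (j%:R * (theta N l / 2))
    + sin (j%:R * (theta N k / 2)) * sin (j%:R * (theta N l / 2))) = 2 * (N%:R * (k == l)%:R).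
  have [<-|kl] := eqVneq k l; last by rewrite (sum_cosD_sin (P k) (P l) (Sm kl)) !mulr0.
  rewrite (eq_bigr (fun=> 1)) ?sumr_const ?card_ord; last by move=> j _; rewrite -!expr2 cos2Dsin2.
  by rewrite -mul2n natrM mulr1.
split; last by under eq_bigr do rewrite !hE; exact: sum_cosM_sin.
- under eq_bigr do rewrite !hE; move: HB HD; rewrite sumrB big_split/= => HB HD.
  by lra.
- under eq_bigr do rewrite !hE; move: HB HD; rewrite sumrB big_split/= => HB HD.
  by lra.
Qed.

End Orthogonality.

(** * Real normal-mode coordinates of the chain *)

Section TodaCoordinates.
Context {R : realType} {N : nat}.
Implicit Types (u v w : phase R N) (tau : R).

Lemma mode_bound (k : 'I_N.-1) : (0 < k.+1 < N)%N.
Proof. by case: k => k /=; case: N. Qed.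

Local Notation om k := (@omega R N k.+1).
Local Notation th k := (@theta R N k.+1).

Lemma om_gt0 (k : 'I_N.-1) : 0 < om k. Proof. exact/omega_gt0/mode_bound. Qed.

Lemma om_sqrt (k : 'I_N.-1) : Num.sqrt (om k) * Num.sqrt (om k) = om k.
Proof. by rewrite -expr2 sqr_sqrtr// ltW// om_gt0. Qed.

Lemma om_sqrt_neq0 (k : 'I_N.-1) : Num.sqrt (om k) != 0.
Proof. by rewrite sqrtr_eq0 -ltNge om_gt0. Qed.

(* wave w j is the momentum p_j, and wave w (j + 1/2) is q_j - q_(j+1). *)
Definition wave w tau : R := (Num.sqrt N%:R)^-1 *
  \sum_(k < N.-1) Num.sqrt (om k) * (w.1 0 k * cos (tau * th k) + w.2 0 k * sin (tau * th k)).

(** The positions in the real inverse formula of (p, q) |-> (X, Y): compared with [wave], (X, Y)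
    undergoes a quarter turn and omega^(1/2) becomes omega^(-1/2). *)
Definition posn w tau : R := (Num.sqrt N%:R)^-1 *
  \sum_(k < N.-1) (Num.sqrt (om k))^-1 * (w.2 0 k * cos (tau * th k) - w.1 0 k * sin (tau * th k)).

Definition momenta w : 'rV[R]_N := \row_j wave w j%:R.
Definition positions w : 'rV[R]_N := \row_j posn w j%:R.

Lemma waveD u v tau : wave (u + v) tau = wave u tau + wave v tau.
Proof.
rewrite -mulrDr -big_split; congr (_ * _); apply: eq_bigr => k _ /=.
by rewrite !mxE; ring.
Qed.

Lemma waveZ (a : R) u tau : wave (a *: u) tau = a * wave u tau.
Proof.
rewrite mulrCA mulr_sumr; congr (_ * _); apply: eq_bigr => k _ /=.
by rewrite !mxE; ring.
Qed.

(** A difference over one site multiplies mode k by 2 sin(theta/2) = omega and centres it at the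
    midpoint, which turns omega^(-1/2) into omega^(1/2). *)
Lemma posn_sub w tau : (0 < N)%N -> posn w tau - posn w (tau + 1) = wave w (tau + 2^-1).
Proof.
move=> N0; rewrite -mulrBr -sumrB; congr (_ * _); apply: eq_bigr => k _.
have E : om k = 2 * sin (th k / 2) by rewrite sin_theta_half.
rewrite (_ : tau * th k = (tau + 2^-1) * th k - th k / 2); last by field.
rewrite (_ : (tau + 1) * th k = (tau + 2^-1) * th k + th k / 2); last by field.
apply: (mulfI (om_sqrt_neq0 k)); rewrite mulrBr !mulrA divff ?om_sqrt_neq0// !mul1r om_sqrt E.
by rewrite cosB cosD sinB sinD; ring.
Qed.

Lemma posn_period w tau : (0 < N)%N -> posn w (tau + N%:R) = posn w tau.
Proof.
move=> N0; congr (_ * _); apply: eq_bigr => k _; rewrite mulrDl.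
have [c s] := @period_theta R N k.+1 N0.
by rewrite cosD sinD c s; congr (_ * _); ring.
Qed.

Lemma sum_cos_theta (k : 'I_N.-1) : \sum_(j < N) cos (j%:R * th k) = 0.
Proof.
have kN := mode_bound k; have N0 : (0 < N)%N by case/andP: kN => _; exact: leq_trans.
have [c s] := @period_theta R N k.+1 N0; apply: sum_cos_eq0 => //.
have := om_gt0 k; rewrite -sin_theta_half// => /lt0r_neq0.
by rewrite mulf_eq0 negb_or => /andP[].
Qed.

Lemma sum_sin_theta (k : 'I_N.-1) : \sum_(j < N) sin (j%:R * th k) = 0.
Proof.
have kN := mode_bound k; have N0 : (0 < N)%N by case/andP: kN => _; exact: leq_trans.
by have [c s] := @period_theta R N k.+1 N0; exact: sum_sin_eq0.
Qed.

Lemma zero_sum_momenta w : zero_sum (momenta w).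
Proof.
rewrite /zero_sum; under eq_bigr do rewrite mxE.
rewrite /wave -mulr_sumr exchange_big big1 ?mulr0// => k _.
by rewrite -mulr_sumr big_split/= -!mulr_sumr sum_cos_theta sum_sin_theta !mulr0 addr0 mulr0.
Qed.

Lemma zero_sum_positions w : zero_sum (positions w).
Proof.
rewrite /zero_sum; under eq_bigr do rewrite mxE.
rewrite /posn -mulr_sumr exchange_big big1 ?mulr0// => k _.
by rewrite -mulr_sumr sumrB -!mulr_sumr sum_cos_theta sum_sin_theta !mulr0 subr0 mulr0.
Qed.

Lemma positions_sub w (j : 'I_N) :
  positions w 0 j - positions w 0 (ordS j) = wave w (j%:R + 2^-1).
Proof.
have N0 : (0 < N)%N by apply: leq_trans (ltn_ord j).
rewrite !mxE -posn_sub//; congr (_ - _) => /=.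
(* At the last site [ordS] returns to 0, and the N-periodicity of [posn] closes the chain. *)
have := ltn_ord j; rewrite leq_eqVlt => /orP[/eqP jN|jN].
  rewrite jN modnn (_ : j%:R + 1 = 0 + N%:R); last by rewrite natr1 jN add0r.
  by rewrite posn_period.
by rewrite modn_small// natr1.
Qed.

Lemma sum_wave_half w : \sum_(j < N) wave w (j%:R + 2^-1) = 0.
Proof.
under eq_bigr do rewrite -positions_sub.
rewrite sumrB [X in _ - X](_ : _ = \sum_j positions w 0 j) ?subrr//.
by rewrite [RHS](reindex_inj (@ordS_inj N)).
Qed.

Lemma toda_ham_wave w : toda_ham (momenta w) (positions w) =
  2^-1 * \sum_(j < N) wave w j%:R ^+ 2 + \sum_(j < N) expR (wave w (j%:R + 2^-1)).
Proof.
congr (_ * _ + _); first by under eq_bigr do rewrite mxE.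
by apply: eq_bigr => j _; rewrite positions_sub.
Qed.

Lemma sum_half_steps (f : R -> R) n :
  \sum_(j < n.*2) f (j%:R / 2) = \sum_(j < n) (f j%:R + f (j%:R + 2^-1)).
Proof.
elim: n => [|n IH]; first by rewrite !big_ord0.
rewrite doubleS !big_ord_recr /= IH -addrA; congr (_ + (f _ + f _)).
  by rewrite -mul2n natrM; field.
by rewrite -natr1 -mul2n natrM; field.
Qed.

(** The kinetic part on integer sites and the quadratic potential on half-integer sites together
    sample one wave at 2N points, where the modes are orthogonal. Either part alone would couple the
    modes k and N - k. *)
Lemma energy_form u v : (0 < N)%N ->
  \sum_(j < N) (wave u j%:R * wave v j%:R + wave u (j%:R + 2^-1) * wave v (j%:R + 2^-1)) =
  \sum_(k < N.-1) om k * (u.1 0 k * v.1 0 k + u.2 0 k * v.2 0 k).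
Proof.
move=> N0.
rewrite -(sum_half_steps (fun t => wave u t * wave v t)).
have NR : (N%:R : R) != 0 by rewrite pnatr_eq0 -lt0n.
rewrite (eq_bigr (fun j : 'I_N.*2 => N%:R^-1 * \sum_(k < N.-1) \sum_(l < N.-1) Num.sqrt (om k) * Num.sqrt (om l) *
   (u.1 0 k * v.1 0 l * (cos (j%:R / 2 * th k) * cos (j%:R / 2 * th l))
    + u.2 0 k * v.2 0 l * (sin (j%:R / 2 * th k) * sin (j%:R / 2 * th l))
    + u.1 0 k * v.2 0 l * (cos (j%:R / 2 * th k) * sin (j%:R / 2 * th l))
    + u.2 0 k * v.1 0 l * (cos (j%:R / 2 * th l) * sin (j%:R / 2 * th k))))); last first.
  move=> j _; rewrite /wave mulrACA -invfM -expr2 sqr_sqrtr ?ler0n//; congr (_ * _).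
  rewrite mulr_suml; apply: eq_bigr => k _; rewrite mulr_sumr; apply: eq_bigr => l _.
  by ring.
rewrite -mulr_sumr exchange_big mulr_sumr; apply: eq_bigr => k _.
rewrite exchange_big mulr_sumr (bigD1 k)//= [X in _ + X]big1 ?addr0.
  rewrite -mulr_sumr !big_split/= -!mulr_sumr.
  have [-> -> ->] := half_step_orthogonality (R := R) (mode_bound k) (mode_bound k).
  by rewrite eqxx om_sqrt /= !mulr1 !mulr0 !addr0; field.
move=> l lk; rewrite -mulr_sumr !big_split/= -!mulr_sumr.
have [-> -> ->] := half_step_orthogonality (R := R) (mode_bound k) (mode_bound l).
have [_ _ ->] := half_step_orthogonality (R := R) (mode_bound l) (mode_bound k).
by rewrite eqSS [_ == _](_ : _ = false) /=; [ring|rewrite eq_sym; exact/negbTE].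
Qed.

Definition dft_re (u : 'rV[R]_N) k : R := (Num.sqrt N%:R)^-1 * \sum_j u 0 j * cos (j%:R * theta N k).
Definition dft_im (u : 'rV[R]_N) k : R := (Num.sqrt N%:R)^-1 * \sum_j u 0 j * sin (j%:R * theta N k).

Lemma sum_complex (I : Type) (r : seq I) (a b : I -> R) :
  \sum_(i <- r) (a i +i* b i)%C = ((\sum_(i <- r) a i) +i* (\sum_(i <- r) b i))%C.
Proof. by elim: r => [|i r IH]; rewrite ?big_nil// !big_cons IH. Qed.

Lemma dft_reim (u : 'rV[R]_N) k : dft u k = (dft_re u k +i* dft_im u k)%C.
Proof.
rewrite /dft (eq_bigr (fun j => (u 0 j * cos (j%:R * theta N k) +i* (u 0 j * sin (j%:R * theta N k)))%C)).
  by rewrite sum_complex; apply/eqP; rewrite eq_complex /= !mul0r subr0 addr0 !eqxx.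
move=> j _; rewrite /expi (_ : 2 * pi * _ / _ = j%:R * theta N k).
  by apply/eqP; rewrite eq_complex /= !mul0r subr0 addr0 !eqxx.
by rewrite /theta natrM; ring.
Qed.

Lemma dft_reflect (u : 'rV[R]_N) k : (0 < k < N)%N -> dft u (N - k) = (dft_re u k -i* dft_im u k)%C.
Proof.
move=> /andP[k0 kN]; have N0 : (N%:R : R) != 0 by rewrite pnatr_eq0 -lt0n (leq_trans _ kN).
have th' (j : 'I_N) : j%:R * theta N (N - k) = j%:R * (2 * pi) - j%:R * theta N k :> R.
  by rewrite /theta natrB ?(ltnW kN)//; field.
rewrite dft_reim /dft_re /dft_im -mulrN -sumrN; congr (_ * _ +i* (_ * _))%C.
  by apply: eq_bigr => j _; rewrite th' cosB cos_nat2pi sin_nat2pi; ring.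
by apply: eq_bigr => j _; rewrite th' sinB cos_nat2pi sin_nat2pi; ring.
Qed.

(** The left-hand sides are the real and imaginary parts of the numerator of [toda_xi]. The
    contributions of mode N - k to the two transforms cancel because [omega] has the same value at k
    and N - k. *)
Lemma dft_momenta_positions w (k : 'I_N.-1) :
  dft_re (momenta w) k.+1 - om k * dft_im (positions w) k.+1 = Num.sqrt (om k) * w.1 0 k /\
  dft_im (momenta w) k.+1 + om k * dft_re (positions w) k.+1 = Num.sqrt (om k) * w.2 0 k.
Proof.
have kN := mode_bound k; have N0 : (0 < N)%N by case/andP: kN => _; exact: leq_trans.
have NR : (N%:R : R) != 0 by rewrite pnatr_eq0 -lt0n.
have NN x : (Num.sqrt N%:R)^-1 * ((Num.sqrt N%:R)^-1 * x) = N%:R^-1 * x :> R.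
  by rewrite mulrA -invfM -expr2 sqr_sqrtr.
have om0 (l : 'I_N.-1) : Num.sqrt (om l) != 0 by exact: om_sqrt_neq0.
have P1 := fun l => @sum_cosM_sin R N _ _ (period_theta k.+1 N0) (period_theta l N0).
have P2 := fun l => @sum_cosM_sin R N _ _ (period_theta l N0) (period_theta k.+1 N0).
split.
- rewrite [LHS](_ : _ = (Num.sqrt N%:R)^-1 * \sum_(j < N) (momenta w 0 j * cos (j%:R * th k)
      - om k * (positions w 0 j * sin (j%:R * th k)))); last first.
    by rewrite sumrB -mulr_sumr /dft_re /dft_im; ring.
  rewrite (eq_bigr (fun j : 'I_N => (Num.sqrt N%:R)^-1 * \sum_(l < N.-1) (Num.sqrt (om l))^-1 *
    (w.1 0 l * (om l * (cos (j%:R * th k) * cos (j%:R * th l))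
               + om k * (sin (j%:R * th k) * sin (j%:R * th l)))
     + w.2 0 l * om l * (cos (j%:R * th k) * sin (j%:R * th l))
     - w.2 0 l * om k * (cos (j%:R * th l) * sin (j%:R * th k))))); last first.
    move=> j _; rewrite !mxE /wave /posn; set A := \sum_(l < N.-1) _; set B := \sum_(l < N.-1) _.
    rewrite [LHS](_ : _ = (Num.sqrt N%:R)^-1 * (A * cos (j%:R * th k) - om k * (B * sin (j%:R * th k)))); last by ring.
    congr (_ * _); rewrite {}/A {}/B mulr_suml mulr_suml mulr_sumr -sumrB; apply: eq_bigr => l _.
    move: (om_sqrt_neq0 l) (om_sqrt l); move: (Num.sqrt (om l)) => S S0 <-.
    by field.
  rewrite -mulr_sumr NN exchange_big (bigD1 k)//= [X in _ + X]big1 ?addr0.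
    rewrite -mulr_sumr !big_split /= sumrN -!mulr_sumr dft_orthogonality_cos// eqxx P1.
    move: (om_sqrt_neq0 k) (om_sqrt k); move: (Num.sqrt (om k)) => S S0 <-.
    by rewrite /=; field; rewrite ?NR ?S0.
  move=> l lk; rewrite -mulr_sumr !big_split /= sumrN -!mulr_sumr.
  rewrite dft_orthogonality_cos ?mode_bound// P1 P2 eqSS [_ == _](_ : _ = false).
    by rewrite /=; ring.
  by rewrite eq_sym; exact/negbTE.
- rewrite [LHS](_ : _ = (Num.sqrt N%:R)^-1 * \sum_(j < N) (momenta w 0 j * sin (j%:R * th k)
      + om k * (positions w 0 j * cos (j%:R * th k)))); last first.
    by rewrite big_split/= -mulr_sumr /dft_re /dft_im; ring.
  rewrite (eq_bigr (fun j : 'I_N => (Num.sqrt N%:R)^-1 * \sum_(l < N.-1) (Num.sqrt (om l))^-1 *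
    (w.2 0 l * (om l * (sin (j%:R * th k) * sin (j%:R * th l))
               + om k * (cos (j%:R * th k) * cos (j%:R * th l)))
     + w.1 0 l * om l * (cos (j%:R * th l) * sin (j%:R * th k))
     - w.1 0 l * om k * (cos (j%:R * th k) * sin (j%:R * th l))))); last first.
    move=> j _; rewrite !mxE /wave /posn; set A := \sum_(l < N.-1) _; set B := \sum_(l < N.-1) _.
    rewrite [LHS](_ : _ = (Num.sqrt N%:R)^-1 * (A * sin (j%:R * th k) + om k * (B * cos (j%:R * th k)))); last by ring.
    congr (_ * _); rewrite {}/A {}/B mulr_suml mulr_suml mulr_sumr -big_split/=; apply: eq_bigr => l _.
    move: (om_sqrt_neq0 l) (om_sqrt l); move: (Num.sqrt (om l)) => S S0 <-.
    by field.
  rewrite -mulr_sumr NN exchange_big (bigD1 k)//= [X in _ + X]big1 ?addr0.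
    rewrite -mulr_sumr !big_split /= sumrN -!mulr_sumr dft_orthogonality_sin// eqxx P1.
    move: (om_sqrt_neq0 k) (om_sqrt k); move: (Num.sqrt (om k)) => S S0 <-.
    by rewrite /=; field; rewrite ?NR ?S0.
  move=> l lk; rewrite -mulr_sumr !big_split /= sumrN -!mulr_sumr.
  rewrite dft_orthogonality_sin ?mode_bound// P1 P2 eqSS [_ == _](_ : _ = false).
    by rewrite /=; ring.
  by rewrite eq_sym; exact/negbTE.
Qed.

(** Every real point comes from explicit zero-sum [p] and [q], so [toda_action_only] yields an
    identity for the Hamiltonian at each point. For real data [toda_eta] is the complex conjugate of
    [toda_xi], by [dft_reflect]. *)
Lemma toda_XY_momenta_positions w : toda_XY (momenta w) (positions w) = complexify w.
Proof.
have RC (x : R) : x != 0 -> (x%:C)%C != 0.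
  by move=> x0; rewrite eq_complex /= negb_and x0.
have s2 : Num.sqrt 2 != 0 :> R by rewrite sqrtr_eq0 -ltNge.
have s2om (k : 'I_N.-1) : Num.sqrt 2 * Num.sqrt (2 * om k) = 2 * Num.sqrt (om k).
  by rewrite sqrtrM// mulrA -expr2 sqr_sqrtr.
have som (k : 'I_N.-1) : Num.sqrt (2 * om k) != 0 by rewrite sqrtr_eq0 -ltNge mulr_gt0// om_gt0.
congr pair; apply/rowP => k; rewrite !mxE /toda_xi /toda_eta !dft_reflect ?mode_bound// !dft_reim;
  have [E1 E2] := dft_momenta_positions w k.
- rewrite -mulrDl; apply: (canLR (mulfK (RC _ s2))); apply: (canLR (mulfK (RC _ (som k)))).
  apply/eqP; rewrite eq_complex /=; apply/andP; split; apply/eqP.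
    transitivity (2 * (Num.sqrt (om k) * w.1 0 k)); first by rewrite -E1; ring.
    by transitivity (w.1 0 k * (Num.sqrt 2 * Num.sqrt (2 * om k))); [rewrite s2om|]; ring.
  by ring.
- rewrite -mulrBl; apply: (canLR (mulfK _)).
    by rewrite mulf_neq0 ?RC// eq_complex /= negb_and oner_neq0 orbT.
  apply: (canLR (mulfK (RC _ (som k)))).
  apply/eqP; rewrite eq_complex /=; apply/andP; split; apply/eqP.
    by ring.
  transitivity (2 * (Num.sqrt (om k) * w.2 0 k)); first by rewrite -E2; ring.
  by transitivity (w.2 0 k * (Num.sqrt 2 * Num.sqrt (2 * om k))); [rewrite s2om|]; ring.
Qed.

End TodaCoordinates.

(** * Low-order terms of a Birkhoff map *)

Section LowOrder.
Context {R : realType}.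

Lemma expR_cubic_remainder (x : R) : `|x| <= 1 ->
  `|expR x - (1 + x + x ^+ 2 / 2 + x ^+ 3 / 6)| <= expR 1 * x ^+ 4.
Proof.
move=> x1; set P := (1 + _ + _ + _).
have PE : P = series (exp_coeff x) 4.
  rewrite /series /= big_mkord !big_ord_recr big_ord0 /= /exp_coeff /=.
  by rewrite !factS fact0 /P; field.
have cP : series (exp_coeff x) @ \oo --> expR x by exact: is_cvg_series_exp_coeff.
apply: (cvgr_to_le (cvg_norm (cvgB cP (cvg_cst P)))).
near=> n; rewrite [leLHS](_ : _ = `|series (exp_coeff x) n - P|)//.
have n4 : (4 <= n)%N by near: n; exact: nbhs_infty_ge.
rewrite PE /series /= [X in X - _](@big_cat_nat _ _ _ 4)//= addrAC subrr add0r.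
apply: le_trans (ler_norm_sum _ _ _) _.
apply: le_trans (_ : (\sum_(0 <= i < n) exp_coeff 1 i) * x ^+ 4 <= _); last first.
  rewrite ler_wpM2r ?exprn_even_ge0//.
  apply: (nondecreasing_cvgn_le _ (@is_cvg_series_exp_coeff R 1)).
  apply/nondecreasing_seqP => m.
  by rewrite /series /= big_nat_recr//= lerDl exp_coeff_ge0.
rewrite mulr_suml [leRHS](@big_cat_nat _ _ _ 4)//=.
rewrite -[leLHS]add0r lerD//.
  by apply: sumr_ge0 => i _; rewrite mulr_ge0 ?exp_coeff_ge0// exprn_even_ge0.
rewrite [leLHS]big_nat_cond [leRHS]big_nat_cond.
apply: ler_sum => i /andP[/andP[i4 _] _].
rewrite /exp_coeff /= expr1n div1r normrM normrX mulrC.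
rewrite (@ger0_norm _ (_^-1)) ?invr_ge0// ler_wpM2l ?invr_ge0//.
have -> : x ^+ 4 = `|x| ^+ 4 by rewrite -normrX ger0_norm// exprn_even_ge0.
by rewrite ler_wiXn2l.
Unshelve. all: by end_near.
Qed.

Lemma cvgr_sum (T : Type) (F : set_system T) {FF : Filter F} (I : Type) (r : seq I)
    (f : I -> T -> R) (l : I -> R) : (forall i, f i @ F --> l i) ->
  (fun t => \sum_(i <- r) f i t) @ F --> \sum_(i <- r) l i.
Proof.
move=> Hf; elim: r => [|i r IH].
  by rewrite big_nil; under eq_fun do rewrite big_nil; exact: cvg_cst.
by rewrite big_cons; under eq_fun do rewrite big_cons; exact: cvgD.
Qed.

Context {N : nat}.
Implicit Types (u v w : phase R N) (F : phase R N -> phase R N).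

(** Taylor coefficients are extracted as one-sided limits of coordinates: these pass through the
    finite sums in [wave], [sympl_form] and [energy], and t > 0 allows division by powers of t. *)
Definition phase_cvg (f : R -> phase R N) w : Prop :=
  forall i, (fun t => phase_coord (f t) i) @ 0^'+ --> phase_coord w i.

Lemma phase_cvg_cst w : phase_cvg (fun=> w) w.
Proof. by move=> i; exact: cvg_cst. Qed.

Lemma cvg_wave f w tau : phase_cvg f w -> (fun t => wave (f t) tau) @ 0^'+ --> wave w tau.
Proof.
move=> fw; apply: cvgM; first exact: cvg_cst.
apply: cvgr_sum => k; apply: cvgM; first exact: cvg_cst.
by apply: cvgD; apply: cvgM; try exact: cvg_cst; [exact: fw (inl k)|exact: fw (inr k)].
Qed.

Lemma cvg_sympl_form f g u v : phase_cvg f u -> phase_cvg g v ->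
  (fun t => sympl_form (f t) (g t)) @ 0^'+ --> sympl_form u v.
Proof.
move=> fu gv; apply: cvgr_sum => k; apply: cvgB; apply: cvgM.
- exact: fu (inl k).
- exact: gv (inr k).
- exact: gv (inl k).
- exact: fu (inr k).
Qed.

Lemma sympl_formD u u' v : sympl_form (u + u') v = sympl_form u v + sympl_form u' v.
Proof. by rewrite -big_split; apply: eq_bigr => k _ /=; rewrite !mxE; ring. Qed.

Lemma sympl_formZ (a : R) u v : sympl_form (a *: u) v = a * sympl_form u v.
Proof. by rewrite mulr_sumr; apply: eq_bigr => k _ /=; rewrite !mxE; ring. Qed.

Lemma sympl_formN u v : sympl_form u v = - sympl_form v u.
Proof. by rewrite -sumrN; apply: eq_bigr => k _ /=; ring. Qed.

Lemma sympl_formDr u v v' : sympl_form u (v + v') = sympl_form u v + sympl_form u v'.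
Proof. by rewrite sympl_formN sympl_formD opprD -!sympl_formN. Qed.

Lemma sympl_formZr (a : R) u v : sympl_form u (a *: v) = a * sympl_form u v.
Proof. by rewrite sympl_formN sympl_formZ -mulrN -sympl_formN. Qed.

Lemma cvg_of_linear_bound (f : R -> R) (l C d : R) : 0 < d ->
  (forall t, 0 < t -> t <= d -> `|f t - l| <= C * t) -> f @ 0^'+ --> l.
Proof.
move=> d0 H; apply/cvgrPdist_le => e e0; near=> t.
have t0 : 0 < t by near: t; exact: nbhs_right_gt.
rewrite distrC; apply: le_trans (H t t0 _) _.
  by near: t; exact: nbhs_right_le.
apply: le_trans (_ : (`|C| + 1) * t <= _).
  by rewrite ler_wpM2r ?(ltW t0)// (le_trans (ler_norm _))// lerDl.
have C1 : 0 < `|C| + 1 by apply: lt_le_trans ltr01 _; rewrite lerDr.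
rewrite mulrC -ler_pdivlMr//.
by near: t; apply: nbhs_right_le; rewrite divr_gt0.
Unshelve. all: by end_near.
Qed.

Lemma cvg_diff_along F u w : real_analytic F ->
  phase_cvg (fun t => t^-1 *: ('d F (t *: w) u - 'd F 0 u)) (diff2 F 0 u w).
Proof.
move=> /second_jet[beta [_ d2 _ dF]] i; have [C [d [d0 H]]] := dF u.
have W1 : 0 < `|w| + 1 by apply: lt_le_trans ltr01 _; rewrite lerDr.
apply: (@cvg_of_linear_bound _ _ (C * `|w| ^+ 2) (d / (`|w| + 1))); first by rewrite divr_gt0.
move=> t t0; rewrite ler_pdivlMr// => td.
have hx j : `|phase_coord (t *: w) j| <= t * `|w|.
  by rewrite phase_coordZ normrM gtr0_norm// ler_wpM2l ?(ltW t0)// phase_coord_norm.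
have x0 : 0 <= t * `|w| by rewrite mulr_ge0 ?(ltW t0).
have xd : t * `|w| <= d by apply: le_trans td; rewrite ler_wpM2l ?(ltW t0)// lerDl.
have := H _ _ hx x0 xd i; rewrite bformZ -d2 => Hi.
rewrite -(@ler_pM2l _ t)// -{1}(gtr0_norm t0) -normrM.
have E (A B : phase R N) (c : R) : t * (phase_coord (t^-1 *: (A - B)) i - c) =
    phase_coord A i - phase_coord B i - t * c.
  by rewrite phase_coordZ phase_coordD phase_coordN; field; rewrite gt_eqF.
rewrite [X in `|X|]E; apply: le_trans Hi _.
by rewrite le_eqVlt; apply/orP; left; apply/eqP; ring.
Qed.

Lemma cvg_second_order F w : real_analytic F -> F 0 = 0 -> (forall v, 'd F 0 v = v) ->
  phase_cvg (fun t => t ^- 2 *: (F (t *: w) - t *: w)) (2^-1 *: diff2 F 0 w w).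
Proof.
move=> /second_jet[beta [_ d2 [C [d [d0 H]]] _]] F0 dF0 i.
have W1 : 0 < `|w| + 1 by apply: lt_le_trans ltr01 _; rewrite lerDr.
apply: (@cvg_of_linear_bound _ _ (C * `|w| ^+ 3) (d / (`|w| + 1))); first by rewrite divr_gt0.
move=> t t0; rewrite ler_pdivlMr// => td.
have hx j : `|phase_coord (t *: w) j| <= t * `|w|.
  by rewrite phase_coordZ normrM gtr0_norm// ler_wpM2l ?(ltW t0)// phase_coord_norm.
have x0 : 0 <= t * `|w| by rewrite mulr_ge0 ?(ltW t0).
have xd : t * `|w| <= d by apply: le_trans td; rewrite ler_wpM2l ?(ltW t0)// lerDl.
have bZ : bform (beta i) (t *: w) w = t * bform (beta i) w w.
  rewrite mulr_sumr; apply: eq_bigr => j _; rewrite mulr_sumr; apply: eq_bigr => k _.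
  by rewrite phase_coordZ; ring.
have := H _ _ hx x0 xd i; rewrite [X in _ - X - _](_ : _ = phase_coord (t *: w) i); last first.
  by rewrite dF0.
rewrite F0 phase_coord0 subr0 bformZ bZ -d2 => Hi.
have t20 : 0 < t ^+ 2 by rewrite exprn_gt0.
rewrite -(@ler_pM2l _ (t ^+ 2))// -{1}(gtr0_norm t20) -normrM.
have E (A B D : phase R N) : t ^+ 2 * (phase_coord (t ^- 2 *: (A - B)) i - phase_coord (2^-1 *: D) i)
    = phase_coord A i - phase_coord B i - t * (t * phase_coord D i) / 2.
  by rewrite !phase_coordZ phase_coordD phase_coordN; field; rewrite gt_eqF.
rewrite [X in `|X|]E; apply: le_trans Hi _.
by rewrite le_eqVlt; apply/orP; left; apply/eqP; ring.
Qed.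

(** Write ['d F (t *: w) u = u + t *: D u t] in the invariance of the form. The terms of order zero
    cancel, and division by t leaves the first-order terms plus [t * sympl_form (D u t) (D v t)],
    which tends to 0. *)
Lemma symplectic_diff2 F u v w : real_analytic F -> (forall v, 'd F 0 v = v) ->
  symplectic F -> sympl_form (diff2 F 0 u w) v + sympl_form u (diff2 F 0 v w) = 0.
Proof.
move=> HF dF0 sF; pose D u t := t^-1 *: ('d F (t *: w) u - 'd F 0 u).
have cD u' : phase_cvg (D u') (diff2 F 0 u' w) by exact: cvg_diff_along.
have c1 := cvg_sympl_form (cD u) (@phase_cvg_cst v).
have c2 := cvg_sympl_form (@phase_cvg_cst u) (cD v).
have c3 : (fun t => t * sympl_form (D u t) (D v t)) @ 0^'+ --> 0.
  rewrite -[X in _ --> X](mul0r (sympl_form (diff2 F 0 u w) (diff2 F 0 v w))).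
  by apply: cvgM; [exact: cvg_within|exact: cvg_sympl_form].
have H : (fun t => sympl_form (D u t) v + sympl_form u (D v t)
    + t * sympl_form (D u t) (D v t)) @ 0^'+
    --> sympl_form (diff2 F 0 u w) v + sympl_form u (diff2 F 0 v w).
  by rewrite -[X in _ --> X]addr0; apply: cvgD => //; apply: cvgD.
rewrite -(cvg_lim (@Rhausdorff R) H); apply: cvg_lim; first exact: Rhausdorff.
have H0 : (fun=> 0 : R) @ (0 : R)^'+ --> (0 : R) by exact: cvg_cst.
apply: cvg_trans H0; apply: near_eq_cvg; near=> t.
have t0 : 0 < t by near: t; exact: nbhs_right_gt.
apply/esym; apply: (@mulfI _ t); first by rewrite gt_eqF.
have Eg (A B C : phase R N) : B = C -> A = C + t *: (t^-1 *: (A - B)).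
  by move=> ->; rewrite scalerA divff ?gt_eqF// scale1r addrC subrK.
have E u' : 'd F (t *: w) u' = u' + t *: D u' t by exact: Eg (dF0 u').
have := sF (t *: w) u v; rewrite [X in sympl_form X _](E u) [X in sympl_form _ X](E v).
rewrite sympl_formD !sympl_formDr !sympl_formZ !sympl_formZr => H1.
by lra.
Unshelve. all: by end_near.
Qed.

End LowOrder.

(** * The cubic part of the Hamiltonian in Birkhoff coordinates *)

Section CubicIdentity.
Context {R : realType} {N : nat}.
Implicit Types (u v w z : phase R N) (F : phase R N -> phase R N).

(** Polar form of 2 H_2, where H_2 is the quadratic part of the Hamiltonian. *)
Definition energy u v : R :=
  \sum_(k < N.-1) omega N k.+1 * (u.1 0 k * v.1 0 k + u.2 0 k * v.2 0 k).

Lemma energyC u v : energy u v = energy v u.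
Proof. by apply: eq_bigr => k _; ring. Qed.

Lemma energyZr (a : R) u v : energy u (a *: v) = a * energy u v.
Proof. by rewrite mulr_sumr; apply: eq_bigr => k _ /=; rewrite !mxE; ring. Qed.

Lemma energy_lin2 (a b : R) u v : energy (a *: u + b *: v) (a *: u + b *: v) =
  a ^+ 2 * energy u u + 2 * (a * b) * energy u v + b ^+ 2 * energy v v.
Proof.
rewrite !mulr_sumr -!big_split; apply: eq_bigr => k _ /=.
by rewrite !mxE; ring.
Qed.

Lemma cvg_energy f g u v : phase_cvg f u -> phase_cvg g v ->
  (fun t => energy (f t) (g t)) @ 0^'+ --> energy u v.
Proof.
move=> fu gv; apply: cvgr_sum => k; apply: cvgM; first exact: cvg_cst.
apply: cvgD; apply: cvgM.
- exact: fu (inl k).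
- exact: gv (inl k).
- exact: fu (inr k).
- exact: gv (inr k).
Qed.

Definition exp_tail (x : R) : R := expR x - 1 - x - x ^+ 2 / 2.

Lemma cvg_exp_tail (a : R -> R) (l : R) : a @ 0^'+ --> l ->
  (fun t => t ^- 3 * exp_tail (t * a t)) @ 0^'+ --> l ^+ 3 / 6.
Proof.
move=> al.
have t0 : (id : R -> R) @ (0 : R)^'+ --> (0 : R) by exact: cvg_within.
have a2 : (fun t => a t ^+ 2) @ 0^'+ --> l ^+ 2 by rewrite expr2; apply: cvgM.
have a3 : (fun t => a t ^+ 3) @ 0^'+ --> l ^+ 3.
  by rewrite exprS; under eq_fun do rewrite exprS; apply: cvgM.
have ta : (fun t => t * a t) @ 0^'+ --> 0 by rewrite -[X in _ --> X](mul0r l); apply: cvgM.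
have a4 : (fun t => expR 1 * (t * a t ^+ 4)) @ 0^'+ --> 0.
  rewrite -[X in _ --> X](mulr0 (expR 1)); apply: cvgM; first exact: cvg_cst.
  rewrite -[X in _ --> X](mul0r (l ^+ 2 * l ^+ 2)); apply: cvgM => //.
  by under eq_fun do rewrite (exprD _ 2 2); apply: cvgM.
pose rho t := t ^- 3 * exp_tail (t * a t) - a t ^+ 3 / 6.
have rho0 : rho @ 0^'+ --> 0.
  apply: norm_cvg0.
  apply: (@squeeze_cvgr _ _ _ _ (fun=> 0) (fun t => expR 1 * (t * a t ^+ 4))) => //; last exact: cvg_cst.
  near=> t; rewrite normr_ge0/=.
  have tgt0 : 0 < t by near: t; exact: nbhs_right_gt.
  have ta1 : `|t * a t| <= 1.
    by near: t; move/cvgr0Pnorm_le : ta; apply.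
  have t30 : 0 < t ^+ 3 by rewrite exprn_gt0.
  rewrite -(ler_pM2l t30) -{1}(gtr0_norm t30) -normrM.
  rewrite [X in `|X|](_ : _ = expR (t * a t)
      - (1 + t * a t + (t * a t) ^+ 2 / 2 + (t * a t) ^+ 3 / 6)); last first.
    by rewrite /rho /exp_tail; field; rewrite gt_eqF.
  apply: le_trans (expR_cubic_remainder ta1) _.
  by rewrite le_eqVlt; apply/orP; left; apply/eqP; ring.
rewrite -[X in _ --> X]addr0.
have -> : (fun t => t ^- 3 * exp_tail (t * a t)) = (fun t => a t ^+ 3 / 6 + rho t).
  by apply/funext => t; rewrite /rho addrC subrK.
by apply: cvgD => //; apply: cvgM => //; exact: cvg_cst.
Unshelve. all: by end_near.
Qed.

(** The constant terms of the exponentials add up to N, their linear terms cancel since the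
    half-site samples sum to zero, and their quadratic terms join the kinetic part through
    [energy_form]. *)
Lemma toda_ham_expansion z : (0 < N)%N -> toda_ham (momenta z) (positions z) =
  N%:R + 2^-1 * energy z z + \sum_(j < N) exp_tail (wave z (j%:R + 2^-1)).
Proof.
move=> N0; rewrite toda_ham_wave /energy -energy_form// /exp_tail !sumrB sum_wave_half.
rewrite sumr_const card_ord big_split/=.
rewrite [in X in _ + _ * (X + _)](eq_bigr (fun j : 'I_N => wave z j%:R ^+ 2)); last first.
  by move=> j _; rewrite expr2.
rewrite [in X in _ + _ * (_ + X)](eq_bigr (fun j : 'I_N => wave z (j%:R + 2^-1) ^+ 2)); last first.
  by move=> j _; rewrite expr2.
by rewrite -mulr_suml; field.
Qed.

Lemma toda_ham_even F w (t : R) : toda_action_only F ->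
  toda_ham (momenta (F (t *: - w))) (positions (F (t *: - w))) =
  toda_ham (momenta (F (t *: w))) (positions (F (t *: w))).
Proof.
move=> [h Hh].
have E z : toda_ham (momenta (F z)) (positions (F z)) = h (actions z).
  apply: Hh; [exact: zero_sum_momenta|exact: zero_sum_positions|].
  exact: toda_XY_momenta_positions.
rewrite !E; congr (h _); apply/rowP => k; rewrite !mxE.
by rewrite !mulrN !sqrrN.
Qed.

(** With F (t w) = t w + t^2 r(t), where r(t) tends to Q(w,w)/2, order three receives the cross term
    of the quadratic energy and the cubic terms of the exponentials at w; r(t) changes the
    exponential tails only beyond order three. *)
Lemma cvg_toda_ham_third_order F w : (0 < N)%N -> real_analytic F -> F 0 = 0 ->
  (forall v, 'd F 0 v = v) ->
  (fun t : R => t ^- 3 * (toda_ham (momenta (F (t *: w))) (positions (F (t *: w)))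
       - N%:R - 2^-1 * t ^+ 2 * energy w w)) @ 0^'+ -->
  2^-1 * energy w (diff2 F 0 w w) + \sum_(j < N) wave w (j%:R + 2^-1) ^+ 3 / 6.
Proof.
move=> N0 HF F0 dF0; have rQ := @cvg_second_order _ _ F w HF F0 dF0.
move: rQ; set r := (fun t => t ^- 2 *: _); set Q := _ *: diff2 F 0 w w => rQ.
have FE t : 0 < t -> F (t *: w) = t *: w + t ^+ 2 *: r t.
  by move=> t0; rewrite /r scalerA divff ?expf_neq0 ?gt_eqF// scale1r addrC subrK.
have t0 : (id : R -> R) @ (0 : R)^'+ --> (0 : R) by exact: cvg_within.
pose a (j : 'I_N) t := wave w (j%:R + 2^-1) + t * wave (r t) (j%:R + 2^-1).
have ca j : a j @ 0^'+ --> wave w (j%:R + 2^-1).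
  rewrite -[X in _ --> X]addr0 -[X in _ --> _ + X](mul0r (wave Q (j%:R + 2^-1))).
  by apply: cvgD; [exact: cvg_cst|apply: cvgM => //; exact: cvg_wave].
have H : (fun t => energy w (r t) + 2^-1 * (t * energy (r t) (r t))
    + \sum_(j < N) t ^- 3 * exp_tail (t * a j t)) @ 0^'+ -->
    2^-1 * energy w (diff2 F 0 w w) + \sum_(j < N) wave w (j%:R + 2^-1) ^+ 3 / 6.
  apply: cvgD; last by apply: cvgr_sum => j; exact: cvg_exp_tail.
  rewrite -[X in _ --> X]addr0 -energyZr; apply: cvgD.
    by apply: cvg_energy => //; exact: phase_cvg_cst.
  rewrite -[X in _ --> X](mulr0 2^-1); apply: cvgM; first exact: cvg_cst.
  by rewrite -[X in _ --> X](mul0r (energy Q Q)); apply: cvgM => //; exact: cvg_energy.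
apply: cvg_trans H; apply: near_eq_cvg; near=> t.
have tgt0 : 0 < t by near: t; exact: nbhs_right_gt.
rewrite toda_ham_expansion// FE// -mulr_sumr.
have tn0 : t != 0 by rewrite gt_eqF.
have -> : energy (t *: w + t ^+ 2 *: r t) (t *: w + t ^+ 2 *: r t) =
    t ^+ 2 * energy w w + 2 * t ^+ 3 * energy w (r t) + t ^+ 4 * energy (r t) (r t).
  by rewrite energy_lin2; ring.
have -> : \sum_(j < N) exp_tail (wave (t *: w + t ^+ 2 *: r t) (j%:R + 2^-1)) =
    \sum_(j < N) exp_tail (t * a j t).
  by apply: eq_bigr => j _; rewrite waveD (waveZ t w) (waveZ _ (r t)) /a; congr exp_tail; ring.
by field.
Unshelve. all: by end_near.
Qed.

(* The Hamiltonian along F (t w) is even in w, while its coefficient of t ^ 3 is odd in w. *)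
Lemma birkhoff_cubic F w : (0 < N)%N -> birkhoff_map F ->
  3 * energy w (diff2 F 0 w w) = - \sum_(j < N) wave w (j%:R + 2^-1) ^+ 3.
Proof.
move=> N0 [[HF _] _ F0 aF dF0].
have H1 := @cvg_toda_ham_third_order F w N0 HF F0 dF0.
have H2 := @cvg_toda_ham_third_order F (- w) N0 HF F0 dF0.
have [beta [_ d2 _ _]] := second_jet HF.
have QN : diff2 F 0 (- w) (- w) = diff2 F 0 w w.
  apply: phase_coord_inj => i; rewrite !d2; apply: eq_bigr => j _; apply: eq_bigr => k _.
  by rewrite !phase_coordN; ring.
have eN v : energy (- w) v = - energy w v.
  by rewrite energyC -scaleN1r energyZr energyC mulN1r.
have wN tau : wave (- w) tau = - wave w tau by rewrite -scaleN1r waveZ mulN1r.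
move: H2; rewrite QN !eN [energy w (- w)]energyC eN opprK.
under eq_fun do rewrite toda_ham_even//.
under eq_bigr do rewrite wN.
move=> /(cvg_lim (@Rhausdorff R)); rewrite (cvg_lim (@Rhausdorff R) H1).
rewrite -!mulr_suml [X in _ = _ + X / 6](_ : _ = - \sum_(j < N) wave w (j%:R + 2^-1) ^+ 3).
  by lra.
by rewrite -sumrN; apply: eq_bigr => j _; ring.
Qed.

End CubicIdentity.

(** * The small divisor *)

Section SmallDivisor.
Context {R : realType}.

Lemma sin_le_id (x : R) : 0 <= x -> sin x <= x.
Proof.
rewrite le_eqVlt => /orP[/eqP <-|x0]; first by rewrite sin0.
have [|c _] := @MVT R sin cos 0 x x0 (fun y _ => is_derive_sin y).
  exact/continuous_subspaceT/continuous_sin.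
rewrite sin0 !subr0 => ->; rewrite ler_piMl ?(ltW x0)// cos_le1.
Qed.

Lemma cos_ge_quadratic (x : R) : 0 <= x -> 1 - x ^+ 2 / 2 <= cos x.
Proof.
move=> x0; have h0 : 0 <= x / 2 by rewrite divr_ge0.
have -> : cos x = cos ((x / 2) *+ 2) by congr cos; rewrite -mulr_natr divfK.
rewrite cos_mulr2n cos2sin2.
have [xl|xg] := leP (x / 2) 1; last first.
  have := @sin2cos2 R (x / 2); have := sqr_ge0 (cos (x / 2)); have : 1 < (x / 2) ^+ 2 by rewrite exprn_egt1.
  lra.
have s0 : 0 <= sin (x / 2).
  apply: sin_ge0_pi; rewrite h0 (le_trans xl)//; apply: le_trans (pi_ge2 R); lra.
have : sin (x / 2) ^+ 2 <= (x / 2) ^+ 2 by rewrite lerXn2r ?nnegrE// sin_le_id.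
lra.
Qed.

Lemma cos_ge_half (x : R) : 0 <= x -> x <= 1 -> 2^-1 <= cos x.
Proof.
move=> x0 x1; apply: le_trans (cos_ge_quadratic x0).
have : x ^+ 2 <= 1 by rewrite exprn_ile1.
lra.
Qed.

Lemma sin_ge_half (x : R) : 0 <= x -> x <= 1 -> x / 2 <= sin x.
Proof.
rewrite le_eqVlt => /orP[/eqP <-|x0] x1; first by rewrite sin0 mul0r.
have [|c] := @MVT R sin cos 0 x x0 (fun y _ => is_derive_sin y).
  exact/continuous_subspaceT/continuous_sin.
rewrite in_itv/= => /andP[c0 cx]; rewrite sin0 !subr0 => ->.
rewrite mulrC ler_wpM2r ?(ltW x0)// cos_ge_half ?(ltW c0)//.
exact: le_trans (ltW cx) x1.
Qed.

Lemma omega_bounds (N : nat) : (4 <= N)%N ->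
  [/\ @omega R N 1 <= 8 / N%:R, 2 / N%:R <= @omega R N 2 &
    forall Z : R, (2 * omega N 1 - omega N 2) * Z =
      omega N 1 * Num.sqrt (omega N 2) / Num.sqrt N%:R -> N%:R / 8 <= Z].
Proof.
move=> N4; have N0 : (0 : R) < N%:R by rewrite ltr0n (leq_trans _ N4).
pose x : R := pi / N%:R.
have pi4 : (pi : R) < 4 by have := pihalf_lt2 R; lra.
have x0 : 0 < x by rewrite divr_gt0 ?pi_gt0.
have x4 : x <= 4 / N%:R by rewrite ler_pM2r ?invr_gt0// ltW.
have x2 : 2 / N%:R <= x by rewrite ler_pM2r ?invr_gt0// pi_ge2.
have x1 : x <= 1.
  by apply: le_trans x4 _; rewrite ler_pdivrMr// mul1r (ler_nat R 4).
have o1 : omega N 1 = 2 * sin x by rewrite /omega mul1r.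
have o2 : omega N 2 = 4 * (sin x * cos x).
  rewrite /omega (_ : 2 * pi / N%:R = x *+ 2); last by rewrite -[RHS]mulr_natl mulrA.
  by rewrite sin_mulr2n; ring.
have sx := sin_ge_half (ltW x0) x1; have cx := cos_ge_half (ltW x0) x1.
have s0 : 0 < sin x by apply: lt_le_trans sx; rewrite divr_gt0.
have b0 : x <= omega N 2.
  rewrite o2; apply: le_trans (_ : 4 * (x / 2 * 2^-1) <= _); first by lra.
  rewrite ler_pM2l// ler_pM//.
  by rewrite divr_ge0// ltW.
split.
- by rewrite o1; have := sin_le_id (ltW x0); lra.
- exact: le_trans b0.
move=> Z; rewrite o1 {1}o2 => H.
have n0 : 0 < Num.sqrt N%:R :> R by rewrite sqrtr_gt0.
have bb : 0 < Num.sqrt (omega N 2) :> R by rewrite sqrtr_gt0 (lt_le_trans x0).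
have E : 2 * (1 - cos x) * Z * Num.sqrt N%:R = Num.sqrt (omega N 2).
  apply: (@mulfI _ (2 * sin x)); first by rewrite mulf_neq0// gt_eqF.
  rewrite -[RHS](divfK (_ : Num.sqrt N%:R != 0)) ?gt_eqF// -H; ring.
have c1 := cos_le1 x; have c2 := cos_ge_quadratic (ltW x0).
have Z0 : 0 < Z.
  rewrite ltNge; apply/negP => Zn; move: bb; rewrite -E ltNge => /negP; apply.
  by rewrite mulr_le0_ge0 ?(ltW n0)// mulr_ge0_le0//; lra.
have E2 : Num.sqrt (omega N 2) <= x ^+ 2 * Z * Num.sqrt N%:R.
  by rewrite -E ler_wpM2r ?(ltW n0)// ler_wpM2r ?(ltW Z0)//; lra.
have E3 : omega N 2 <= (x ^+ 2 * Z) ^+ 2 * N%:R.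
  rewrite -[leLHS]sqr_sqrtr ?(le_trans (ltW x0))//.
  rewrite -[X in _ * X](@sqr_sqrtr _ N%:R) ?(ltW N0)// -exprMn lerXn2r// nnegrE.
    exact: ltW.
  by apply: mulr_ge0; [apply: mulr_ge0; [exact: sqr_ge0|exact: ltW]|exact: ltW].
have E4 : 1 <= Z ^+ 2 * x ^+ 3 * N%:R.
  rewrite -(ler_pM2l x0) mulr1; apply: le_trans (le_trans b0 E3) _.
  by rewrite le_eqVlt; apply/orP; left; apply/eqP; ring.
have x3 : x ^+ 3 <= (4 / N%:R) ^+ 3 by rewrite lerXn2r ?nnegrE ?(ltW x0)// divr_ge0// ltW.
have E5 : 1 <= Z ^+ 2 * (4 / N%:R) ^+ 3 * N%:R.
  by apply: le_trans E4 _; rewrite ler_wpM2r ?(ltW N0)// ler_wpM2l ?sqr_ge0.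
suff : (N%:R / 8) ^+ 2 <= Z ^+ 2.
  by rewrite ler_pXn2r// nnegrE ?(ltW Z0)// divr_ge0// ltW.
have Nn : (N%:R : R) != 0 by rewrite gt_eqF.
pose c : R := (4 / N%:R) ^+ 3 * N%:R.
have c0 : 0 < c by rewrite mulr_gt0// exprn_gt0// divr_gt0.
rewrite -(ler_pM2r c0) [leRHS]mulrA; apply: le_trans E5.
by rewrite le_eqVlt; apply/orP; left; apply/eqP; rewrite /c; field.
Qed.

End SmallDivisor.

(** * The homological equation and its resonant component *)

Section Resonance.
Context {R : realType} {N : nat}.
Implicit Types (u v w : phase R N) (k l : 'I_N.-1) (F : phase R N -> phase R N).

Definition mode k (x y : R) : phase R N := (x *: delta_mx 0 k, y *: delta_mx 0 k).

Lemma sum_delta k (f : 'I_N.-1 -> R) : (forall l, l != k -> f l = 0) -> \sum_l f l = f k.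
Proof. by move=> H; rewrite (bigD1 k)//= big1 ?addr0// => l; exact: H. Qed.

Lemma mode_coord k x y l :
  (mode k x y).1 0 l = x * (l == k)%:R /\ (mode k x y).2 0 l = y * (l == k)%:R.
Proof. by rewrite !mxE !eqxx. Qed.

Lemma modeD k x y x' y' : mode k x y + mode k x' y' = mode k (x + x') (y + y').
Proof. by congr pair; rewrite /= -scalerDl. Qed.

Lemma modeZ k (a : R) x y : a *: mode k x y = mode k (a * x) (a * y).
Proof. by congr pair; rewrite /= scalerA. Qed.

Lemma wave_mode k x y tau : wave (mode k x y) tau = (Num.sqrt N%:R)^-1 *
  (Num.sqrt (omega N k.+1) * (x * cos (tau * theta N k.+1) + y * sin (tau * theta N k.+1))).
Proof.
rewrite /wave (sum_delta (k := k)); last first.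
  by move=> l /negPf lk; have [-> ->] := mode_coord k x y l; rewrite lk /= !mulr0 !mul0r addr0 mulr0.
by have [-> ->] := mode_coord k x y k; rewrite eqxx !mulr1.
Qed.

Lemma sympl_form_mode u k x y : sympl_form u (mode k x y) = u.1 0 k * y - x * u.2 0 k.
Proof.
rewrite /sympl_form (sum_delta (k := k)); last first.
  by move=> l /negPf lk; have [-> ->] := mode_coord k x y l; rewrite lk /= !mulr0 mul0r subrr.
by have [-> ->] := mode_coord k x y k; rewrite eqxx !mulr1.
Qed.

(* Generator of the flow of H_2. *)
Definition rot u : phase R N :=
  (\row_k (- omega N k.+1 * u.2 0 k), \row_k (omega N k.+1 * u.1 0 k)).

Lemma rotD u v : rot (u + v) = rot u + rot v.
Proof. by congr pair; apply/rowP => k; rewrite !mxE; ring. Qed.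

Lemma rot_mode k x y : rot (mode k x y) = mode k (- omega N k.+1 * y) (omega N k.+1 * x).
Proof.
by congr pair; apply/rowP => l; have [E1 E2] := mode_coord k x y l;
  rewrite !mxE ?E1 ?E2 !eqxx /=; case: eqVneq => [->|_]; rewrite ?mulr0 ?mulr1.
Qed.

(** Through this formula the term [energy w (diff2 F 0 w w)] of the cubic identity becomes T(w, w,
    rot w). *)
Lemma energy_rot u v : energy u v = sympl_form v (rot u).
Proof. by apply: eq_bigr => k _; rewrite !mxE; ring. Qed.

(** Only the first two arguments commute, since the form to be polarized is T(u, v, rot w).
    Inclusion-exclusion on diagonal values therefore leaves one term for each choice of the last
    argument. *)
Lemma symmetric_polarization (t : phase R N -> phase R N -> phase R N -> R) :
  (forall u u' v w, t (u + u') v w = t u v w + t u' v w) ->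
  (forall u v v' w, t u (v + v') w = t u v w + t u v' w) ->
  (forall u v w w', t u v (w + w') = t u v w + t u v w') ->
  (forall u v w, t u v w = t v u w) ->
  forall u v w, let p z := t z z z in
    p (u + v + w) - p (u + v) - p (u + w) - p (v + w) + p u + p v + p w =
    2 * (t u v w + t u w v + t v w u).
Proof.
move=> D1 D2 D3 C u v w p; rewrite /p !D1 !D2 !D3.
rewrite (C v u u) (C v u v) (C v u w) (C w u u) (C w u v) (C w u w).
rewrite (C w v u) (C w v v) (C w v w).
by ring.
Qed.

Definition wave3 u v w : R :=
  \sum_(j < N) wave u (j%:R + 2^-1) * wave v (j%:R + 2^-1) * wave w (j%:R + 2^-1).

Section Birkhoff.
Variable F : phase R N -> phase R N.
Hypothesis HF : birkhoff_map F.
Hypothesis N0 : (0 < N)%N.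

Let Q u v := diff2 F 0 u v.
Let T u v w := sympl_form (Q u v) w.

Lemma birkhoff_diff2_bilinear :
  [/\ forall u v, Q u v = Q v u, forall u v w, Q u (v + w) = Q u v + Q u w
    & forall u v (a : R), Q u (a *: v) = a *: Q u v].
Proof.
have [[aF _] _ _ _ _] := HF; have [beta [betaC d2 _ _]] := second_jet aF.
split.
- by move=> u v; apply: phase_coord_inj => i; rewrite !d2 bformC.
- by move=> u v w; apply: phase_coord_inj => i; rewrite phase_coordD !d2 bformD.
- by move=> u v a; apply: phase_coord_inj => i; rewrite phase_coordZ !d2 bformZ.
Qed.

Lemma trilinear_sym12 u v w : T u v w = T v u w.
Proof. by have [QC _ _] := birkhoff_diff2_bilinear; rewrite /T QC. Qed.

Lemma trilinear_sym13 u v w : T u v w = T w v u.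
Proof.
have [[aF _] sF _ _ dF0] := HF.
have := @symplectic_diff2 _ _ F u w v aF dF0 sF; rewrite -/(Q u v) -/(Q w v).
by rewrite /T [sympl_form u _]sympl_formN => /eqP; rewrite subr_eq0 => /eqP.
Qed.

Lemma trilinearD1 u u' v w : T (u + u') v w = T u v w + T u' v w.
Proof.
have [QC QD _] := birkhoff_diff2_bilinear.
by rewrite /T QC QD sympl_formD (QC v) (QC v u').
Qed.

Lemma trilinearD2 u v v' w : T u (v + v') w = T u v w + T u v' w.
Proof. by have [_ QD _] := birkhoff_diff2_bilinear; rewrite /T QD sympl_formD. Qed.

Lemma trilinearD3 u v w w' : T u v (w + w') = T u v w + T u v w'.
Proof. exact: sympl_formDr. Qed.

Lemma homological_equation u v w :
  T u v (rot w) + T u w (rot v) + T v w (rot u) = - wave3 u v w.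
Proof.
pose t u v w := T u v (rot w).
have p1 z : 3 * t z z z = - wave3 z z z.
  rewrite /t /T -energy_rot birkhoff_cubic//; congr (- _); apply: eq_bigr => j _.
  by rewrite !exprS expr0 mulr1 mulrA.
have D1 a b c d : t (a + b) c d = t a c d + t b c d by exact: trilinearD1.
have D2 a b c d : t a (b + c) d = t a b d + t a c d by exact: trilinearD2.
have D3 a b c d : t a b (c + d) = t a b c + t a b d by rewrite /t rotD trilinearD3.
have C a b c : t a b c = t b a c by exact: trilinear_sym12.
have E1 := symmetric_polarization D1 D2 D3 C u v w.
have W1 a b c d : wave3 (a + b) c d = wave3 a c d + wave3 b c d.
  by rewrite /wave3 -big_split; apply: eq_bigr => j _; rewrite waveD /=; ring.
have W2 a b c d : wave3 a (b + c) d = wave3 a b d + wave3 a c d.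
  by rewrite /wave3 -big_split; apply: eq_bigr => j _; rewrite waveD /=; ring.
have W3 a b c d : wave3 a b (c + d) = wave3 a b c + wave3 a b d.
  by rewrite /wave3 -big_split; apply: eq_bigr => j _; rewrite waveD /=; ring.
have W a b c : wave3 a b c = wave3 b a c by apply: eq_bigr => j _; ring.
have E2 := symmetric_polarization W1 W2 W3 W u v w.
have C1 : wave3 u w v = wave3 u v w by apply: eq_bigr => j _; ring.
have C2 : wave3 v w u = wave3 u v w by apply: eq_bigr => j _; ring.
rewrite /= C1 C2 in E2.
have arith (P1 P2 P3 P4 P5 P6 P7 W1' W2' W3' W4 W5 W6 W7 X Y Z A : R) :
    3 * P1 = - W1' -> 3 * P2 = - W2' -> 3 * P3 = - W3' -> 3 * P4 = - W4 ->
    3 * P5 = - W5 -> 3 * P6 = - W6 -> 3 * P7 = - W7 ->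
    P1 - P2 - P3 - P4 + P5 + P6 + P7 = 2 * (X + Y + Z) ->
    W1' - W2' - W3' - W4 + W5 + W6 + W7 = 2 * (A + A + A) -> X + Y + Z = - A by lra.
exact: (arith _ _ _ _ _ _ _ _ _ _ _ _ _ _ _ _ _ _
  (p1 _) (p1 _) (p1 _) (p1 _) (p1 _) (p1 _) (p1 _) E1 E2).
Qed.

End Birkhoff.
End Resonance.

Section AbstractResonance.
Context {R : comRingType} {V : lmodType R}.
Variable t : V -> V -> V -> R.
Hypothesis t12 : forall u v w, t u v w = t v u w.
Hypothesis t13 : forall u v w, t u v w = t w v u.
Hypothesis tD : forall u v w w', t u v (w + w') = t u v w + t u v w'.
Hypothesis tZ : forall u v (c : R) w, t u v (c *: w) = c * t u v w.

(** The complex vectors z = e - i e' and g = f + i f' are eigenvectors of [B] for i a and - i b. The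
    homological equation at (z, z, g) reads i (2a - b) t(z,z,g) = - rho(z,z,g), and the identity is
    its real part: the bracket on the left is Im t(z,z,g), the right-hand side is Re rho(z,z,g). *)
Lemma resonance_identity (rho : V -> V -> V -> R) (B : V -> V) (a b : R) e e' f f' :
  (forall u v w, t u v (B w) + t u w (B v) + t v w (B u) = - rho u v w) ->
  B e = a *: e' -> B e' = - a *: e -> B f = b *: f' -> B f' = - b *: f ->
  (2 * a - b) * (t e e f' - t e' e' f' - 2 * t e e' f) =
  rho e e f - rho e' e' f + 2 * rho e e' f'.
Proof.
move=> H re re' rf rf'.
have E1 := H e e f; have E2 := H e' e' f; have E3 := H e e' f'.
rewrite rf re !tZ (t12 e f e') (t13 f e e') (t12 e' e f) in E1.
rewrite rf re' !tZ (t12 e' f e) (t13 f e' e) in E2.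
rewrite rf' re re' !tZ (t12 e f' e) (t13 f' e e) (t12 e' f' e') (t13 f' e' e') in E3.
rewrite -[rho e e f]opprK -E1 -[rho e' e' f]opprK -E2 -[rho e e' f']opprK -E3; ring.
Qed.

Lemma mixed_polarization e e' f :
  4 * t e e' f = t (e + e') (e + e') f - t (e + (-1) *: e') (e + (-1) *: e') f.
Proof.
have D1 u v w z : t (u + v) w z = t u w z + t v w z by rewrite t13 tD t13 (t13 z w v).
have D2 u v w z : t u (v + w) z = t u v z + t u w z by rewrite t12 D1 t12 (t12 w).
have Z1 c u v w : t (c *: u) v w = c * t u v w by rewrite t13 tZ t13.
have Z2 c u v w : t u (c *: v) w = c * t u v w by rewrite t12 Z1 t12.
by rewrite !D1 !D2 !Z1 !Z2 (t12 e' e); ring.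
Qed.

End AbstractResonance.

(** Origin of the factor 3: each of the two diagonal terms contributes less than D, and so does
    twice the mixed term, which is half a difference of two values below D in modulus. *)
Lemma direction_arith (R : realFieldType) (D z0 z1 z2 z3 z4 : R) :
  z1 < D -> - D < z2 -> z3 < D -> - D < z3 -> z4 < D -> - D < z4 ->
  3 * D <= z1 - z2 - 2 * - z0 -> 4 * - z0 = - z3 - - z4 -> False.
Proof. lra. Qed.

Section LowerBound.
Context {R : realType} {N : nat}.
Variable F : phase R N -> phase R N.
Hypothesis HF : birkhoff_map F.
Variables k1 k2 : 'I_N.-1.
Hypotheses (k1E : k1 = 0%N :> nat) (k2E : k2 = 1%N :> nat).

Let Q u v := diff2 F 0 u v.
Let T u v w := sympl_form (Q u v) w.

Let N0 : (0 < N)%N.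
Proof. by have := ltn_ord k2; rewrite k2E; case: N. Qed.

(** If mode 1 has phase psi at a site, mode 2 has phase 2 psi, and the combination is cos(2 psi)^2 +
    sin(2 psi)^2 = 1 up to a constant factor. Nothing oscillates along the chain: the N equal terms,
    each with a factor N^(-3/2), add up to N^(-1/2). *)
Lemma resonant_wave3 :
  wave3 (mode k1 1 0) (mode k1 1 0) (mode k2 1 0)
  - wave3 (mode k1 0 1) (mode k1 0 1) (mode k2 1 0)
  + 2 * wave3 (mode k1 1 0) (mode k1 0 1) (mode k2 0 1)
  = omega N 1 * Num.sqrt (omega N 2) / Num.sqrt N%:R :> R.
Proof.
rewrite /wave3 mulr_sumr -sumrB -big_split/=.
have NR : (N%:R : R) != 0 by rewrite pnatr_eq0 -lt0n.
have n0 : Num.sqrt N%:R != 0 :> R by rewrite sqrtr_eq0 -ltNge ltr0n.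
have nn : Num.sqrt N%:R * Num.sqrt N%:R = N%:R :> R by rewrite -expr2 sqr_sqrtr.
have aa : Num.sqrt (omega N 1) * Num.sqrt (omega N 1) = omega N 1 :> R.
  by rewrite -expr2 sqr_sqrtr// ltW// omega_gt0//; have := ltn_ord k2; rewrite k2E; case: N => // -[].
pose K : R := (Num.sqrt N%:R)^-1 * (Num.sqrt N%:R)^-1 * (Num.sqrt N%:R)^-1 *
  (Num.sqrt (omega N 1) * Num.sqrt (omega N 1) * Num.sqrt (omega N 2)).
rewrite (eq_bigr (fun=> K)).
  have KN : K *+ N = K * (Num.sqrt N%:R * Num.sqrt N%:R) by rewrite nn mulr_natr.
  rewrite sumr_const card_ord KN /K aa.
  by move: (Num.sqrt N%:R) n0 => s s0; field.
move=> j _; rewrite !wave_mode k1E k2E.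
set psi : R := (j%:R + 2^-1) * theta N 1.
rewrite (_ : _ * theta N 2 = psi + psi); last by rewrite /psi /theta; ring.
rewrite cosD sinD /K; have cs := cos2Dsin2 psi.
transitivity ((Num.sqrt N%:R)^-1 * (Num.sqrt N%:R)^-1 * (Num.sqrt N%:R)^-1 *
  (Num.sqrt (omega N 1) * Num.sqrt (omega N 1) * Num.sqrt (omega N 2))
   * (cos psi ^+ 2 + sin psi ^+ 2) ^+ 2).
  by ring.
by rewrite cs expr1n mulr1.
Qed.

Lemma resonant_coefficient :
  (2 * omega N 1 - omega N 2) * (T (mode k1 1 0) (mode k1 1 0) (mode k2 0 1)
    - T (mode k1 0 1) (mode k1 0 1) (mode k2 0 1)
    - 2 * T (mode k1 1 0) (mode k1 0 1) (mode k2 1 0))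
  = omega N 1 * Num.sqrt (omega N 2) / Num.sqrt N%:R.
Proof.
rewrite -resonant_wave3.
set a := omega N 1; set b := omega N 2.
set e := mode k1 1 0; set e' := mode k1 0 1; set f := mode k2 1 0; set f' := mode k2 0 1.
have re : rot e = a *: e' by rewrite rot_mode modeZ k1E; congr mode; ring.
have re' : rot e' = - a *: e by rewrite rot_mode modeZ k1E; congr mode; ring.
have rf : rot f = b *: f' by rewrite rot_mode modeZ k2E; congr mode; ring.
have rf' : rot f' = - b *: f by rewrite rot_mode modeZ k2E; congr mode; ring.
have T12 u v w : T u v w = T v u w by exact: trilinear_sym12.
have T13 u v w : T u v w = T w v u by exact: trilinear_sym13.
have TZ u v (c : R) w : T u v (c *: w) = c * T u v w by exact: sympl_formZr.
have H u v w : T u v (rot w) + T u w (rot v) + T v w (rot u) = - wave3 u v w.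
  exact: homological_equation.
exact: (resonance_identity T12 T13 TZ H re re' rf rf').
Qed.

(* Polarizing T e e' over e + e' and e - e' leaves only diagonal values of Q. *)
Lemma large_diff2_direction (D : R) : 0 < D ->
  3 * D <= T (mode k1 1 0) (mode k1 1 0) (mode k2 0 1)
    - T (mode k1 0 1) (mode k1 0 1) (mode k2 0 1)
    - 2 * T (mode k1 1 0) (mode k1 0 1) (mode k2 1 0) ->
  exists x y : R, x ^+ 2 + y ^+ 2 <= 2 /\
    let q := Q (mode k1 x y) (mode k1 x y) in D ^+ 2 <= q.1 0 k2 ^+ 2 + q.2 0 k2 ^+ 2.
Proof.
move=> D0 HD.
set e := mode k1 1 0 in HD; set e' := mode k1 0 1 in HD.
set f := mode k2 1 0 in HD; set f' := mode k2 0 1 in HD.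
have pol : 4 * T e e' f = T (e + e') (e + e') f - T (e + (-1) *: e') (e + (-1) *: e') f.
  have T12 u v w : T u v w = T v u w by exact: trilinear_sym12.
  have T13 u v w : T u v w = T w v u by exact: trilinear_sym13.
  have TD u v w w' : T u v (w + w') = T u v w + T u v w' by exact: sympl_formDr.
  have TZ u v (c : R) w : T u v (c *: w) = c * T u v w by exact: sympl_formZr.
  exact: (mixed_polarization T12 T13 TD TZ).
have pE : e + e' = mode k1 1 1 by rewrite modeD; congr mode; ring.
have mE : e + (-1) *: e' = mode k1 1 (-1) by rewrite modeZ modeD; congr mode; ring.
rewrite pE mE in pol.
have Tf u v : T u v f = - (Q u v).2 0 k2.
  by rewrite /T sympl_form_mode; ring.
have Tf' u v : T u v f' = (Q u v).1 0 k2.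
  by rewrite /T sympl_form_mode; ring.
apply: contrapT => Hn.
have small x y : x ^+ 2 + y ^+ 2 <= 2 -> let q := Q (mode k1 x y) (mode k1 x y) in
    [/\ q.1 0 k2 < D, - D < q.1 0 k2, q.2 0 k2 < D & - D < q.2 0 k2].
  move=> xy q; have : q.1 0 k2 ^+ 2 + q.2 0 k2 ^+ 2 < D ^+ 2.
    by rewrite ltNge; apply/negP => H; apply: Hn; exists x, y.
  move: (q.1 0 k2) (q.2 0 k2) => s t H.
  have Hs : `|s| < D.
    rewrite -(@ltr_pXn2r _ 2)// ?nnegrE ?(ltW D0)// real_normK ?num_real//.
    by apply: le_lt_trans H; rewrite lerDl sqr_ge0.
  have Ht : `|t| < D.
    rewrite -(@ltr_pXn2r _ 2)// ?nnegrE ?(ltW D0)// real_normK ?num_real//.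
    by apply: le_lt_trans H; rewrite lerDr sqr_ge0.
  by move: Hs Ht; rewrite !ltr_norml => /andP[? ?] /andP[? ?].
(* The four test directions are e, e', e + e' and e - e'; the last two account for the bound 2 on
   [x ^+ 2 + y ^+ 2]. *)
have [|s1 _ _ _] := small 1 0; first by rewrite expr1n expr0n addr0 ler1n.
have [|_ s2 _ _] := small 0 1; first by rewrite expr1n expr0n add0r ler1n.
have [|_ _ s3 s4] := small 1 1; first by rewrite expr1n.
have [|_ _ s5 s6] := small 1 (-1); first by rewrite sqrrN expr1n.
move: HD pol; rewrite !Tf' !Tf => HD pol.
exact: (direction_arith s1 s2 s3 s4 s5 s6 HD pol).
Qed.

End LowerBound.

(** * The weighted norm on modes 1 and 2 *)

Section Norms.
Context {R : realType} {N : nat}.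
Implicit Types (v : phase R N) (s sigma : R).

Definition weight s sigma (k : nat) : R :=
  (circ_dist N k)%:R `^ (2 * s) * expR (2 * sigma * (circ_dist N k)%:R).

Lemma Pnorm_complexify s sigma v : Pnorm s sigma (complexify v) =
  Num.sqrt (N%:R^-1 * \sum_(k < N.-1) (weight s sigma k.+1 * omega N k.+1 *
    ((v.1 0 k ^+ 2 + v.2 0 k ^+ 2) / 2))).
Proof.
have nc (x : R) : ComplexField.Normc.normc (x%:C)%C ^+ 2 = x ^+ 2.
  by rewrite /ComplexField.Normc.normc /= expr0n addr0 sqr_sqrtr ?sqr_ge0.
congr (Num.sqrt (_ * _)); apply: eq_bigr => k _.
by rewrite !mxE !nc.
Qed.

Lemma weight_ge1 s sigma k : 0 <= s -> 0 <= sigma -> (0 < k < N)%N ->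
  1 <= weight s sigma k.
Proof.
move=> s0 sigma0 /andP[k0 kN].
have d1 : (1 : R) <= (circ_dist N k)%:R.
  by rewrite (ler_nat R 1) /circ_dist leq_min k0 subn_gt0.
rewrite /weight -[leLHS]mulr1 ler_pM//.
  by rewrite -[leLHS](powRr0 (circ_dist N k)%:R) ler_powR// mulr_ge0.
by rewrite -[leLHS]expR0 ler_expR mulr_ge0// mulr_ge0.
Qed.

(** Since [1]_N = 1, the polynomial weight is 1 and only the exponential one remains: the constants
    of the theorem will depend on [sigma] alone. *)
Lemma Pnorm_mode1 s sigma (k : 'I_N.-1) (x y : R) : k = 0%N :> nat ->
  Pnorm s sigma (complexify (mode k x y)) =
  Num.sqrt (N%:R^-1 * (expR (2 * sigma) * omega N 1 * ((x ^+ 2 + y ^+ 2) / 2))).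
Proof.
move=> k0; rewrite Pnorm_complexify (sum_delta (k := k)).
  have [-> ->] := mode_coord k x y k; rewrite eqxx !mulr1 k0.
  congr (Num.sqrt (_ * (_ * _ * _))); rewrite /weight.
  have -> : circ_dist N 1 = 1%N.
    rewrite /circ_dist; apply/minn_idPl; rewrite subn_gt0.
    by have := ltn_ord k; rewrite k0; case: N => // -[].
  by rewrite powR1 mul1r mulr1.
move=> l /negPf lk; have [-> ->] := mode_coord k x y l.
by rewrite lk /= !mulr0 expr0n addr0 mul0r mulr0.
Qed.

(** A lower bound may keep a single mode and replace its weight by 1. *)
Lemma Pnorm_ge_coord s sigma v (k : 'I_N.-1) : 0 <= s -> 0 <= sigma ->
  N%:R^-1 * (omega N k.+1 * ((v.1 0 k ^+ 2 + v.2 0 k ^+ 2) / 2))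
  <= Pnorm s sigma (complexify v) ^+ 2.
Proof.
move=> s0 sigma0; have term0 (l : 'I_N.-1) : 0 <= omega N l.+1 * ((v.1 0 l ^+ 2 + v.2 0 l ^+ 2) / 2).
  by rewrite mulr_ge0 ?(ltW (om_gt0 l))// divr_ge0// addr_ge0 ?sqr_ge0.
have w1 (l : 'I_N.-1) := weight_ge1 s0 sigma0 (mode_bound l).
have sum0 : 0 <= \sum_(l < N.-1 | l != k) (weight s sigma l.+1 * omega N l.+1 *
    ((v.1 0 l ^+ 2 + v.2 0 l ^+ 2) / 2)).
  by apply: sumr_ge0 => l _; rewrite -mulrA mulr_ge0// (le_trans ler01).
have le0 : omega N k.+1 * ((v.1 0 k ^+ 2 + v.2 0 k ^+ 2) / 2) <=
    weight s sigma k.+1 * omega N k.+1 * ((v.1 0 k ^+ 2 + v.2 0 k ^+ 2) / 2).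
  by rewrite -mulrA -[leLHS]mul1r ler_wpM2r.
rewrite Pnorm_complexify sqr_sqrtr (bigD1 k)//=.
  by rewrite ler_wpM2l ?invr_ge0// -[leLHS]addr0 lerD.
by rewrite mulr_ge0 ?invr_ge0// addr_ge0// (le_trans _ le0).
Qed.

End Norms.

Lemma quadratic_scaling (R : realType) (N : nat)
    (Q : phase R N -> phase R N -> phase R N) (c : R) v :
  (forall u v, Q u v = Q v u) -> (forall u v (a : R), Q u (a *: v) = a *: Q u v) ->
  Q (c *: v) (c *: v) = c ^+ 2 *: Q v v.
Proof. by move=> QC QZ; rewrite QZ QC QZ scalerA expr2. Qed.

Theorem theorem1p3 (R : realType)
    (Phi : forall N : nat, phase R N -> phase R N)
    (HPhi : forall N : nat, (2 <= N)%N -> birkhoff_map (Phi N))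
    (s sigma : R) (hs : 0 <= s) (hsigma : 0 <= sigma) :
  exists (rho C : R) (N0 : nat), [/\ 0 < rho, 0 < C &
    forall (N : nat) (alpha : R), (2 <= N)%N -> (N0 <= N)%N ->
      ((C * rho ^+ 2 * N%:R `^ (2 - 2 * alpha))%:E <=
       ereal_sup [set (Pnorm s sigma (complexify (diff2 (Phi N) 0 v v)))%:E
                 | v in Pball_real s sigma (rho / N%:R `^ alpha)])%E].
Proof.
(* The exponential cancels the weight of mode 1, and 1/3 is chosen so that its square times the 8 of
   omega_1 <= 8/N is 8/9 < 1: the test vector lies strictly inside the ball. *)
pose c : R := expR (- sigma) / 3.
have c0 : 0 < c by rewrite divr_gt0// expR_gt0.
(* The value 24 is 3 times 8: the resonant combination is at least N/8, and one direction carries a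
   third of it. The threshold 4 is that of [omega_bounds]; it also makes mode 2 available. *)
exists 1, (c ^+ 2 / 24), 4%N; split => //; first by rewrite divr_gt0// exprn_gt0.
move=> N alpha N2 N4; have HF := HPhi N N2.
have N1 : (1 < N.-1)%N by rewrite -ltnS prednK// (leq_trans _ N4).
pose k1 : 'I_N.-1 := Ordinal (ltnW N1); pose k2 : 'I_N.-1 := Ordinal N1.
have n0 : (0 : R) < N%:R by rewrite ltr0n (leq_trans _ N2).
have m0 : 0 < N%:R `^ alpha :> R by rewrite powR_gt0.
set n : R := N%:R in n0 m0 *; set m : R := n `^ alpha in m0 *.
have nn0 : n != 0 by rewrite gt_eqF.
have mn0 : m != 0 by rewrite gt_eqF.
have powE : n `^ (2 - 2 * alpha) = (n / m) ^+ 2.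
  rewrite (_ : 2 - 2 * alpha = (1 - alpha) + (1 - alpha)); last by ring.
  rewrite powRD ?nn0 ?implybT// powRD ?nn0 ?implybT// powRN powRr1 ?(ltW n0)//.
have [a_le b_ge divisor] := @omega_bounds R N N4.
have big := divisor _ (resonant_coefficient (k1 := k1) (k2 := k2) HF erefl erefl).
have D0 : 0 < n / 24 by rewrite divr_gt0.
have [|x [y [xy /= q_ge]]] := large_diff2_direction (k1 := k1) (k2 := k2) HF D0.
  by rewrite (_ : 3 * (n / 24) = n / 8)//; field.
(* On mode 1 the norm is at most of order 1/N times the Euclidean length, so a length of order N /
   N^alpha fits in the ball of radius 1 / N^alpha. *)
pose lam := c * (n / m); have lam0 : 0 < lam by rewrite mulr_gt0// divr_gt0.
pose v := lam *: mode k1 x y.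
apply: (@le_trans _ _ (Pnorm s sigma (complexify (diff2 (Phi N) 0 v v)))%:E).
  rewrite lee_fin.
  have [QC _ QZ] := birkhoff_diff2_bilinear HF.
  rewrite /v (quadratic_scaling _ _ QC QZ).
  set q := diff2 _ _ _ _ in q_ge *.
  have Pge := Pnorm_ge_coord (lam ^+ 2 *: q) k2 hs hsigma.
  rewrite -(@ler_pXn2r _ 2)// ?nnegrE.
  - apply: le_trans Pge.
    rewrite powE !mxE; move: (q.1 0 k2) (q.2 0 k2) q_ge => q1 q2 q_ge.
    rewrite (_ : (c ^+ 2 / 24 * 1 ^+ 2 * (n / m) ^+ 2) ^+ 2 =
      n^-1 * (2 / n * (lam ^+ 2 ^+ 2 * (n / 24) ^+ 2 / 2))); last first.
      by rewrite /lam; field; rewrite nn0 mn0.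
    rewrite ler_wpM2l ?invr_ge0 ?(ltW n0)// ler_pM//.
    + by rewrite divr_ge0// ltW.
    + by rewrite divr_ge0// mulr_ge0 ?sqr_ge0.
    + rewrite ler_pM2r ?invr_gt0// [leRHS](_ : _ = lam ^+ 2 ^+ 2 * (q1 ^+ 2 + q2 ^+ 2)); last by ring.
      by rewrite ler_wpM2l ?sqr_ge0.
  - by rewrite powE; apply: mulr_ge0; [rewrite expr1n mulr1 divr_ge0 ?sqr_ge0|exact: sqr_ge0].
  - exact: sqrtr_ge0.
apply: ereal_sup_ubound; exists v => //.
rewrite /Pball_real /Pball /= /v modeZ Pnorm_mode1//.
have Ec : expR (2 * sigma) * c ^+ 2 = 9^-1.
  have e1 := expRxMexpNx_1 sigma.
  rewrite /c (_ : 2 * sigma = sigma + sigma) ?expRD; last by ring.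
  transitivity ((expR sigma * expR (- sigma)) ^+ 2 / 9); first by field.
  by rewrite e1 expr1n mul1r.
have mi0 : 0 <= 1 / m by rewrite divr_ge0// ltW.
rewrite -[ltRHS](ger0_norm mi0) -sqrtr_sqr ltr_sqrt ?exprn_gt0 ?divr_gt0//.
apply: (@le_lt_trans _ _ (n^-1 * (expR (2 * sigma) * (8 / n) * lam ^+ 2))).
  rewrite ler_wpM2l ?invr_ge0 ?(ltW n0)// ler_pM//.
  - by rewrite mulr_ge0 ?expR_ge0// ltW// omega_gt0//= (leq_trans _ N4).
  - by rewrite divr_ge0// addr_ge0 ?sqr_ge0.
  - by rewrite ler_wpM2l ?expR_ge0.
  - rewrite [leLHS](_ : _ = lam ^+ 2 * ((x ^+ 2 + y ^+ 2) / 2)); last by field.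
    rewrite ler_piMr ?sqr_ge0//.
    by rewrite ler_pdivrMr// mul1r.
rewrite (_ : n^-1 * _ = (expR (2 * sigma) * c ^+ 2) * 8 * (1 / m) ^+ 2).
  by rewrite Ec gtr_pMl ?exprn_gt0 ?divr_gt0// mulrC ltr_pdivrMr// mul1r ltr_nat.
by rewrite /lam; field; rewrite nn0 mn0.
Qed.
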